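(* Fix $\epsilon>0$. Suppose $x\to\infty$ and $$100\le y\le x/\exp((\log_2 x)^{1+\epsilon}).$$ Then $$L(x,y)\le x\,\mathcal{L}(x/y)^{-1+o(1)}.$$
   Context: $\log_k$ denotes the $k$-th iterate of the natural logarithm (so $\log_2 x=\log\log x$). $\lambda(n)$ (Carmichael's function) is the exponent of the multiplicative group $(\mathbb{Z}/n\mathbb{Z})^\times$, and $L(x,y)=\#\{n\le x:\lambda(n)\le y\}$, where $n$ runs over positive integers. $\mathcal{L}(x)=\exp\left(\frac{\log x\,\log_3 x}{\log_2 x}\right)$. The $o(1)$ term tends to $0$ as $x\to\infty$ uniformly in $y$ in the stated range (for fixed $\epsilon$): for each $\eta>0$ there is $x_0(\epsilon,\eta)$ such that $L(x,y)\le x\,\mathcal{L}(x/y)^{-1+\eta}$ for all $x\ge x_0$ and all $y$ in the stated range. *)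

(* Defs.v *)
From mathcomp Require Import all_boot all_order all_algebra finmap.
From mathcomp Require Import fingroup abelian.
From mathcomp Require Import all_classical all_reals all_analysis.

Set Implicit Arguments.
Unset Strict Implicit.
Unset Printing Implicit Defensive.

Import Order.TTheory GRing.Theory Num.Theory.
Local Open Scope ring_scope.

(* The value at n is the intended one for every n > 0. For n = 1 the type 'Z_1
   is Z/2Z rather than the zero ring, but both unit groups are trivial; see
   carmichael1 below. The junk value at n = 0 is never used. *)
Definition carmichael (n : nat) : nat := exponent (units_Zp n).

Fact carmichael1 : carmichael 1 = 1%N.
Proof.
apply/eqP; rewrite -dvdn1 -trivg_exponent; apply/eqP/card1_trivg.
exact: (@card_units_Zp 2).
Qed.

Definition carmichael_count (R : realType) (x y : R) : nat :=
  \sum_(1 <= n < (Num.truncn x).+1 | (carmichael n)%:R <= y) 1.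

Fact carmichael_countP (R : realType) (x y : R) :
  ([set n | [/\ (0 < n)%N, n%:R <= x & (carmichael n)%:R <= y]]
     #= `I_(carmichael_count x y))%classic%card.
Proof.
pose s := [seq n <- index_iota 1 (Num.truncn x).+1 | (carmichael n)%:R <= y].
have -> : [set n | [/\ (0 < n)%N, n%:R <= x & (carmichael n)%:R <= y]]%classic
    = [set` [fset n in s]%fset]%classic.
  have truncn_geE n : (0 < n)%N -> (n <= Num.truncn x)%N = (n%:R <= x).
    by case: n => // n _; rewrite truncn_gt_nat.
  apply/seteqP; split => n /=; rewrite !inE /= mem_filter mem_index_iota ltnS.
    by case=> n0 nx ->; rewrite n0 truncn_geE.
  by case/and3P => ly n0; rewrite truncn_geE.
apply/card_eq_fsetP; rewrite card_fseq undup_id; last first.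
  by rewrite filter_uniq// iota_uniq.
by rewrite /carmichael_count sum1_count size_filter.
Qed.

(* ln is total, with value 0 on nonpositive reals; iter_ln k x is the genuine
   k-th iterated logarithm for all sufficiently large x. *)
Definition iter_ln (R : realType) (k : nat) (x : R) : R := iter k (@ln R) x.

Definition scriptL (R : realType) (x : R) : R :=
  expR (iter_ln 1 x * iter_ln 3 x / iter_ln 2 x).

(* Main.v *)
(* Write u = log (x / y), beta = log log u / log u, and Lam(n) for the lcm of
   the p - 1 with p prime, p | n, which divides carmichael n; recall that the
   theorem asks for a saving exp (-(1 - o(1)) beta u). Writing n = s k^2 with s
   squarefree, Rankin's trick with the weight (x / n)^(1 - beta) (y / Lam(n))^beta
   saves the factor exp (-beta u) and leaves the sum of (s / Lam(s))^beta / s over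
   squarefree s. Adding a prime p to s multiplies s / Lam(s) by about
   gcd (p - 1, Lam(s)), and the Brun-Titchmarsh inequality (through Selberg's sieve)
   bounds the sum of gcd (p - 1, M)^beta / p over p <= x by
   C (log log x) exp (5 S), S being the sum of q^(beta - 1) over the primes q | M.
   The primes q <= u contribute o(log u) to S; those q > u also do, unless s belongs
   to a set that an exponential moment shows to be negligible. Hence the inner sum is
   exp (O ((log log x) u^o(1))), which is exp (o(beta u)) because
   u >= (log log x)^(1 + eps). *)
Require Import Defs.
From mathcomp Require Import all_boot all_order all_algebra.
From mathcomp Require Import fingroup cyclic abelian finfield.
From mathcomp Require Import zify ring lra.
From mathcomp Require Import all_classical all_reals all_analysis.
From mathcomp Require Import finset.
Set Implicit Arguments.
Unset Strict Implicit.
Unset Printing Implicit Defensive.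
Import Order.TTheory GRing.Theory Num.Theory.

(** No useful pointwise bound on S exists, because the lcm attached to a set of primes p may collect
    very many primes q > u. So the part of S above u is replaced by a majorant additive in p, the
    sum of q^(-1/2) over the primes q > u dividing p - 1 ([rough_weight]), whose exponential moment
    factors over p. The scale sqrt u is forced from both sides. Since sqrt (u / q) < 1 for q > u,
    the moment with factor sqrt u costs only a constant multiple of log log x, and cutting at delta
    sqrt u then saves exp (delta u), more than exp (beta u) as beta tends to 0. On the sets that
    remain, q^(beta - 1) <= u^(beta - 1/2) q^(-1/2) bounds the part of S above u by delta u^beta,
    and beta is the exponent with u^beta = log u. Being below the cut passes to subsets, so the sum
    over the remaining sets can be estimated by adding one prime at a time, although its terms are
    not multiplicative. *)

(** * Prime factors, the Carmichael function and square-free parts *)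

(** The Chinese remainder theorem supplies a residue that is [a] modulo [p] and 1 modulo the part of
    [n] prime to [p]; units modulo [p] thus lift to units modulo [n]. *)
Lemma coprime_lift (a p n : nat) : (0 < n)%N -> coprime p a -> prime p ->
  exists b : nat, coprime n b /\ b = a %[mod p].
Proof.
move=> n0 pa p_pr.
have cop : coprime p n`_p^' by rewrite prime_coprime// -p'natE// part_pnat.
exists (chinese p n`_p^' a 1); split; last exact: chinese_modl.
rewrite -{1}(partnC p n0) coprimeMl; apply/andP; split.
  apply: (@coprime_dvdl _ (p ^ logn p n)); first by rewrite p_part.
  by apply: coprimeXl; rewrite -coprime_modr chinese_modl// coprime_modr.
by rewrite -coprime_modr chinese_modr// coprime_modr coprimen1.
Qed.

(** The exponent of the units modulo [n] kills every unit modulo [p], since each one lifts; the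
    units modulo [p] form a cyclic group, whose exponent is its order [p.-1]. *)
Lemma dvdn_pred_carmichael (p n : nat) : (0 < n)%N -> prime p -> (p %| n)%N ->
  (p.-1 %| carmichael n)%N.
Proof.
move=> n0 p_pr pn; set e := carmichael n.
have n1 : (1 < n)%N by apply: leq_trans (prime_gt1 p_pr) (dvdn_leq n0 pn).
have powe a : coprime n a -> a ^ e = 1 %[mod n].
  move=> na; have ua : ((a%:R)%R : 'Z_n) \is a GRing.unit by rewrite unitZpE.
  have : (FinRing.unit 'Z_n ua ^+ e = 1)%g.
    apply/(@exponentP _ (units_Zp n)); first exact: dvdnn.
    by rewrite inE.
  move/(congr1 val); rewrite FinRing.val_unitX /= -natrX => /(congr1 (@nat_of_ord _)).
  by rewrite val_Zp_nat// => ->; rewrite -[in RHS](val_Zp_nat n1).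
have := @exponent_cyclic _ [set: {unit 'F_p}]%G (field_unit_group_cyclic _).
rewrite card_finField_unit card_Fp// => <-.
apply/exponentP => u _; apply: val_inj; rewrite FinRing.val_unitX /=.
have [b [nb ba]] : exists b : nat, coprime n b /\ b = val u %[mod p].
  apply: coprime_lift => //; rewrite -unitFpE//.
  by rewrite (_ : (_ : nat)%:R%R = val u) ?natr_Zp//; case: (u).
rewrite -[X in (X ^+ _)%R](natr_Zp (val u)) -natrX -(Fp_nat_mod p_pr).
rewrite -modnXm -ba modnXm -[1%R]/(1%N%:R)%R -[RHS](Fp_nat_mod p_pr); congr (_%:R)%R.
have /(congr1 (modn^~ p)) := powe _ nb.
by rewrite !modn_dvdm.
Qed.

(** Strong induction removes the least prime factor of [n]; when that prime is already in [G], the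
    two copies move into [k]. The square-free part is kept as a set of primes in a fixed ordinal
    type, so that sums over square-free integers become sums over subsets and arise by expanding
    products. *)
Lemma squarefree_square_decomposition (X n : nat) : (0 < n <= X)%N ->
  exists (G : {set 'I_X.+1}) (k : 'I_X.+1),
    [/\ {in G, forall p : 'I_X.+1, prime p}, (0 < k)%N & n = (\prod_(p in G) p * k ^ 2)%N].
Proof.
elim/ltn_ind: n => n IH /andP[n0 nX].
have [n1|n1] := leqP n 1.
  have -> : n = 1%N by lia.
  have k1 : (1 < X.+1)%N by lia.
  exists set0, (Ordinal k1); split => //; first by move=> p; rewrite in_set0.
  by rewrite big_set0.
set p := pdiv n; have p_pr : prime p by exact: pdiv_prime.
have pn : (p %| n)%N by exact: pdiv_dvd.
have pX : (p < X.+1)%N by have := dvdn_leq n0 pn; lia.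
have nE : n = (p * (n %/ p))%N by rewrite mulnC divnK.
have m0 : (0 < n %/ p)%N by rewrite divn_gt0 ?prime_gt0// dvdn_leq.
have mn : (n %/ p < n)%N by rewrite ltn_Pdiv// prime_gt1.
have mX : (0 < n %/ p <= X)%N by lia.
have [G [k [Gp k0 mE]]] := IH _ mn mX.
have [pG|pG] := boolP (Ordinal pX \in G).
  have kp : (k * p < X.+1)%N.
    have : (k * p <= n)%N.
      rewrite nE mE (bigD1 _ pG)/=; set A := (\big[_/_]_(_ <- _ | _) _).
      have A0 : (0 < A)%N by apply: prodn_cond_gt0 => i /andP[/Gp /prime_gt0].
      rewrite mulnC leq_mul2l; apply/orP; right.
      apply: (leq_trans (leq_pmulr k k0)); rewrite mulnn; apply: leq_pmull.
      by rewrite muln_gt0 A0 prime_gt0.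
    lia.
  exists (G :\ Ordinal pX), (Ordinal kp); split => //=.
  - by move=> q /setD1P[_]; exact: Gp.
  - by rewrite muln_gt0 k0 prime_gt0.
  by rewrite [LHS]nE mE (big_setD1 _ pG)/=; ring.
exists (Ordinal pX |: G), k; split => //.
  by move=> q /setU1P[->//|]; exact: Gp.
by rewrite [LHS]nE mE big_setU1//= mulnA.
Qed.

Lemma count_AP (W b N : nat) : (0 < W)%N ->
  (\sum_(0 <= m < N) (W %| b + m.+1) + b %/ W = (b + N) %/ W)%N.
Proof.
move=> W0; elim: N => [|N IH]; first by rewrite big_geq// addn0.
by rewrite big_nat_recr//= addnAC IH addnS divnS// addnC.
Qed.

(** * Selberg's sieve in arithmetic progressions *)

Local Open Scope ring_scope.

(** As [d] is invertible modulo [W], the divisibility condition confines [m] to a single residue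
    class modulo [W]. *)
Lemma dist_count_AP (R : realFieldType) (W d A N : nat) :
  (0 < W)%N -> (0 < d)%N -> coprime W d ->
  `|\sum_(0 <= m < N) (W %| d * (A + m) + 1)%:R - N%:R / W%:R| <= 1 :> R.
Proof.
(* The residue that is 1 modulo [W] and 0 modulo [d], divided by [d], is an inverse of [d] modulo
   [W]. *)
move=> W0 d0 cWd; pose i := (chinese W d 1 0 %/ d)%N.
have di : (d * i = chinese W d 1 0)%N.
  by rewrite mulnC divnK// /dvdn chinese_modr// mod0n.
have dvdE x : (W %| d * x + 1)%N = (W %| x + i)%N.
  rewrite -(Gauss_dvdr (x + i)%N cWd) mulnDr di.
  by rewrite /dvdn -modnDmr -[in RHS]modnDmr chinese_modl.
(* Adding [W.-1] avoids a negative offset: [b + m.+1] is [A + m + i] shifted by one full period. *)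
pose b := (A + i + W.-1)%N.
have countE : (\sum_(0 <= m < N) (W %| d * (A + m) + 1) + b %/ W = (b + N) %/ W)%N.
  rewrite -count_AP//; congr (_ + _)%N; apply: eq_bigr => m _; rewrite dvdE.
  rewrite (_ : b + m.+1 = A + m + i + W)%N; last by rewrite /b; lia.
  by congr nat_of_bool; rewrite [RHS]dvdn_addl.
rewrite -natr_sum; set c := (\sum_(_ <= _ < _) _)%N in countE *.
have W0' : 0 < W%:R :> R by rewrite ltr0n.
have b1 := divn_eq b W; have r1 := ltn_pmod b W0.
have b2 := divn_eq (b + N) W; have r2 := ltn_pmod (b + N) W0.
have e : (c * W + b %% W * 0 + (b + N) %% W = N + b %% W)%N by nia.
rewrite -(ler_pM2r W0') mul1r -[X in _ * X](gtr0_norm W0') -normrM mulrBl divfK ?gt_eqF//.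
rewrite -natrM ler_norml.
have e' : (c * W)%:R = N%:R + (b %% W)%:R - ((b + N) %% W)%:R :> R.
  by apply/eqP; rewrite eq_sym subr_eq -!natrD; apply/eqP; congr _%:R; lia.
have r1' : (b %% W)%:R <= W%:R :> R by rewrite ler_nat ltnW.
have r2' : ((b + N) %% W)%:R <= W%:R :> R by rewrite ler_nat ltnW.
have p1 : 0 <= (b %% W)%:R :> R by [].
have p2 : 0 <= ((b + N) %% W)%:R :> R by [].
by rewrite e'; lra.
Qed.

(** A general modulus [W] makes the induction on [l] possible: expanding the factor at the head [p]
    reduces the claim for [W] to the claims for [W] and [W * p], and their errors combine with
    coefficients 1 and [|a p|]. *)
Lemma sieve_product (R : realFieldType) (n : nat) (l : seq 'I_n) (a : 'I_n -> R)
    (W d A N : nat) :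
  (0 < W)%N -> (0 < d)%N -> coprime W d -> uniq l ->
  {in l, forall p : 'I_n, [/\ prime p, ~~ (p %| d)%N & coprime W p]} ->
  `|\sum_(0 <= m < N) (W %| d * (A + m) + 1)%:R *
      \prod_(p <- l) (1 + a p * (p %| d * (A + m) + 1)%:R)
    - N%:R / W%:R * \prod_(p <- l) (1 + a p / p%:R)|
  <= \prod_(p <- l) (1 + `|a p|).
Proof.
move=> + d0; elim: l W => [|p l IH] W W0 cWd.
  move=> _ _; rewrite !big_nil mulr1; under eq_bigr do rewrite big_nil mulr1.
  exact: dist_count_AP.
rewrite cons_uniq => /andP[pl ul] H.
have [p_pr pd cWp] := H _ (mem_head _ _).
have cpd : coprime p d by rewrite prime_coprime.
have H1 : {in l, forall q : 'I_n, [/\ prime q, ~~ (q %| d)%N & coprime W q]}.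
  by move=> q ql; apply: H; rewrite in_cons ql orbT.
have H2 : {in l, forall q : 'I_n, [/\ prime q, ~~ (q %| d)%N & coprime (W * p) q]}.
  move=> q ql; have [q_pr qd Wq] := H1 _ ql; split => //.
  rewrite coprimeMl Wq prime_coprime// dvdn_prime2//; apply: contraNneq pl => pq.
  by rewrite (_ : p = q)//; exact: val_inj.
have I1 := IH W W0 cWd ul H1.
have Wp0 : (0 < W * p)%N by rewrite muln_gt0 W0 prime_gt0.
have cWpd : coprime (W * p) d by rewrite coprimeMl cWd.
have I2 := IH _ Wp0 cWpd ul H2.
rewrite !big_cons.
set T1 := \sum_(_ <= _ < _) _ in I1; set T2 := \sum_(_ <= _ < _) _ in I2.
have -> : \sum_(0 <= m < N) (W %| d * (A + m) + 1)%:R *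
    \prod_(q <- p :: l) (1 + a q * (q %| d * (A + m) + 1)%:R) = T1 + a p * T2.
  rewrite /T1 /T2 mulr_sumr -big_split/=; apply: eq_bigr => m _.
  rewrite big_cons Gauss_dvd//.
  by case: (W %| _)%N; case: (p %| _)%N => /=; ring.
set P1 := \prod_(_ <- _) _ in I1 I2 *; set P2 := \prod_(_ <- _) _ in I1 I2 *.
have -> : T1 + a p * T2 - N%:R / W%:R * ((1 + a p / p%:R) * P1) =
    (T1 - N%:R / W%:R * P1) + a p * (T2 - N%:R / (W * p)%:R * P1).
  rewrite natrM invfM; ring.
apply: (le_trans (ler_normD _ _)); rewrite mulrDl mul1r; apply: lerD => //.
by rewrite normrM ler_wpM2l.
Qed.

(** This passes from integers to parametrizations of them. Since [F] is nonnegative, values of [v]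
    that repeat or fall outside [r] do no harm, so uniqueness of the representation is never an
    issue. *)
Lemma sum_le_cover (R : realFieldType) (I : eqType) (J : finType) (r : seq I)
    (Q : pred J) (v : J -> I) (F : I -> R) : uniq r ->
  (forall i, 0 <= F i) -> {in r, forall i, exists2 j, Q j & v j = i} ->
  \sum_(i <- r) F i <= \sum_(j | Q j) F (v j).
Proof.
move=> ur F0 H.
apply: (@le_trans _ _ (\sum_(i <- r) \sum_(j | Q j) (v j == i)%:R * F (v j))).
  rewrite big_seq [leRHS]big_seq; apply: ler_sum => i /H[j Qj <-].
  rewrite (bigD1 j)//= eqxx mul1r lerDl; apply: sumr_ge0 => k _.
  exact: mulr_ge0.
rewrite exchange_big/=; apply: ler_sum => j _; rewrite -mulr_suml.
rewrite ler_piMl// -natr_sum lern1.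
have [vr|vr] := boolP (v j \in r).
  rewrite (bigD1_seq (v j))//= eqxx big1// => i /negbTE; by rewrite eq_sym => ->.
rewrite big_seq big1// => i ir; case: eqP => // e; by rewrite e ir in vr.
Qed.

Lemma mul_sum_pair (R : realFieldType) (I J : finType) (P : pred I) (Q : pred J)
    (f : I -> R) (g : J -> R) :
  \sum_(p : I * J | P p.1 && Q p.2) f p.1 * g p.2 =
  (\sum_(i | P i) f i) * (\sum_(j | Q j) g j).
Proof. by rewrite big_distrlr/= pair_big. Qed.

Lemma sum_subset_prod (R : realFieldType) (I : finType) (D : {set I}) (w : I -> R) :
  \sum_(G : {set I} | G \subset D) \prod_(i in G) w i = \prod_(i in D) (1 + w i).
Proof.
rewrite [RHS]big_mkcond/=.
transitivity (\prod_i ((if i \in D then w i else 0) + 1)).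
  rewrite bigA_distr big_mkcond/=; apply: eq_bigr => G _.
  case: ifPn => [/fintype.subsetP GD|/fintype.subsetPn[i iG iD]].
    rewrite big_mkcond; apply: eq_bigr => i _.
    by case: ifPn => // /GD ->.
  by rewrite (bigD1 i)//= iG (negbTE iD) mul0r.
by apply: eq_bigr => i _; case: ifP => _; ring.
Qed.

Lemma sum_inv_sqr_le2 (R : realFieldType) (Z : nat) :
  \sum_(1 <= k < Z.+1) (k%:R ^+ 2)^-1 <= 2 :> R.
Proof.
case: Z => [|Z]; first by rewrite big_geq ?ler0n.
suff H : \sum_(1 <= k < Z.+2) (k%:R ^+ 2)^-1 <= 2 - (Z.+1)%:R^-1 :> R.
  by apply: (le_trans H); rewrite gerBl.
elim: Z => [|Z IH]; first by rewrite big_nat1 expr1n invr1; lra.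
rewrite big_nat_recr//=; apply: (le_trans (lerD IH (lexx _))).
set a : R := Z.+1%:R; have a0 : 0 < a by rewrite ltr0n.
have -> : Z.+2%:R = a + 1 by rewrite /a -natr1.
rewrite -subr_ge0.
have -> : 2 - (a + 1)^-1 - (2 - a^-1 + (a + 1) ^- 2) = (a * (a + 1) ^+ 2)^-1.
  by field; rewrite !gt_eqF//; lra.
by rewrite invr_ge0; apply: mulr_ge0; [exact: ltW | apply: exprn_ge0; lra].
Qed.

(** A member encodes, by its set of prime factors, a square-free integer up to [Z] that is coprime
    to [d]. *)
Definition sieve_family (Z d : nat) : {pred {set 'I_Z.+1}} :=
  [pred G : {set 'I_Z.+1} |
    (G \subset [set p : 'I_Z.+1 | prime p && ~~ (p %| d)%N]) &&
    (\prod_(p in G) p <= Z)%N].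

Arguments sieve_family : clear implicits.

(** This is the classical Selberg denominator, the sum of 1 / phi(n) over the square-free n <= Z
    coprime to [d]. *)
Definition selberg_sum (R : realFieldType) (Z d : nat) : R :=
  \sum_(G in sieve_family Z d) (\prod_(p in G) (p.-1%:R : R))^-1.

Lemma sieve_familyP (Z d : nat) (G : {set 'I_Z.+1}) : G \in sieve_family Z d ->
  {in G, forall p : 'I_Z.+1, prime p /\ ~~ (p %| d)%N} /\ (\prod_(p in G) p <= Z)%N.
Proof.
by case/andP => /fintype.subsetP GP GZ; split => // p /GP; rewrite inE => /andP.
Qed.

(** For the indicator t of divisibility by p, the function 1 - p t has mean 0 and mean square p - 1.
    Products over different sets are therefore orthogonal up to the error of [sieve_product]. *)
Lemma sieve_correlation (R : realFieldType) (Z d A N : nat) (G H : {set 'I_Z.+1}) :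
  (0 < d)%N -> G \in sieve_family Z d -> H \in sieve_family Z d ->
  \sum_(0 <= m < N)
    (\prod_(p in G) (1 - p%:R * (p %| d * (A + m) + 1)%:R)) *
    (\prod_(p in H) (1 - p%:R * (p %| d * (A + m) + 1)%:R))
  <= (G == H)%:R * N%:R * \prod_(p in G) p.-1%:R + (Z ^ 4)%:R :> R.
Proof.
move=> d0 /sieve_familyP[GP GZ] /sieve_familyP[HP HZ].
have UP p : p \in G :|: H -> prime p /\ ~~ (p %| d)%N.
  by case/setUP => [/GP|/HP].
(* On the intersection the factor is squared, and (1 - p t)^2 = 1 + (p^2 - 2 p) t for an indicator
   t. *)
pose a (p : 'I_Z.+1) : R := if p \in G :&: H then p%:R ^+ 2 - 2 * p%:R else - p%:R.
have p2 (p : 'I_Z.+1) : prime p -> 2 <= (p%:R : R).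
  by move=> /prime_gt1; rewrite (ler_nat R 2).
have lP : {in enum (G :|: H), forall p : 'I_Z.+1, [/\ prime p, ~~ (p %| d)%N & coprime 1 p]}.
  by move=> p; rewrite mem_enum => /UP[]; split => //; exact: coprime1n.
have := @sieve_product R _ _ a 1 d A N isT d0 (coprime1n _) (enum_uniq _) lP.
rewrite !big_enum/= divr1.
under eq_bigr => m _ do rewrite dvd1n mul1r big_enum/=.
move=> bnd.
have -> : \sum_(0 <= m < N)
    (\prod_(p in G) (1 - p%:R * (p %| d * (A + m) + 1)%:R)) *
    (\prod_(p in H) (1 - p%:R * (p %| d * (A + m) + 1)%:R)) =
    \sum_(0 <= m < N) \prod_(p in G :|: H) (1 + a p * (p %| d * (A + m) + 1)%:R) :> R.
  apply: eq_bigr => m _.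
  rewrite big_mkcond [X in _ * X]big_mkcond -big_split [RHS]big_mkcond/=.
  apply: eq_bigr => p _; rewrite /a !inE.
  by case: (p \in G); case: (p \in H) => /=; case: (p %| d * (A + m) + 1)%N => /=; ring.
have main : \prod_(p in G :|: H) (1 + a p / p%:R) = (G == H)%:R * \prod_(p in G) p.-1%:R.
  have [GH|/eqP GH] := eqVneq G H.
    rewrite mul1r -GH setUid; apply: eq_bigr => p pG; rewrite /a -GH setIid pG.
    have [/p2 p2' _] := GP _ pG; rewrite -subn1 natrB; last by have [/prime_gt0] := GP _ pG.
    by field; rewrite gt_eqF//; lra.
  rewrite mul0r; have [p pGH pn] : exists2 p, p \in G :|: H & p \notin G :&: H.
    apply/exists_inP; apply: contra_notT GH; rewrite negb_exists => /forallP h.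
    apply/setP => p; move: (h p); rewrite !inE.
    by case: (p \in G); case: (p \in H).
  have /p2 p2' := (UP _ pGH).1.
  rewrite (bigD1 p)//= /a (negbTE pn) mulNr divff ?subrr ?mul0r// gt_eqF//; lra.
move: bnd; rewrite main ler_norml => /andP[_]; rewrite lerBlDl => /le_trans; apply.
rewrite mulrCA mulrA lerD2l.
(* Each error factor is at most [p ^ 2] because [p] is at least 2, and the primes of the union
   multiply to at most [Z ^ 2]. *)
apply: (@le_trans _ _ (\prod_(p in G :|: H) (p%:R ^+ 2))).
  apply: ler_prod => p /UP[/p2 p2' _]; apply/andP; split; first by rewrite addr_ge0.
  rewrite -[_ ^+ 2](addrNK 1) addrC lerD2r ler_norml /a; case: ifP => _; nra.
rewrite prodrXl -natr_prod -natrX ler_nat (_ : 4 = 2 * 2)%N// expnM leq_exp2r//.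
apply: (@leq_trans (\prod_(p in G) p * \prod_(p in H) p)); last by rewrite -mulnn leq_mul.
rewrite (big_setID G)/= setUK setDUl setDv set0U leq_mul2l; apply/orP; right.
rewrite [leqRHS](big_setID G)/= mulnC; apply: leq_pmulr.
by apply: prodn_cond_gt0 => p /setIP[/HP[/prime_gt0]].
Qed.

Lemma selberg_sum_ge1 (R : realFieldType) (Z d : nat) : (0 < Z)%N ->
  1 <= selberg_sum R Z d.
Proof.
move=> Z0; rewrite /selberg_sum (bigD1 set0)/=; last first.
  by rewrite inE big_set0 Z0 sub0set.
by rewrite big_set0 invr1 lerDl; apply: sumr_ge0 => G _; rewrite invr_ge0 prodr_ge0.
Qed.

(* The dual form of Selberg's sieve: the function [F] below equals the Selberg
   sum at every sifted integer, and its pieces are nearly orthogonal. *)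
Lemma selberg_sieve (R : realFieldType) (Z d A N : nat) (Q : pred nat) :
  (0 < d)%N -> (0 < Z)%N ->
  (forall m p, Q m -> prime p -> (p <= Z)%N -> ~~ (p %| d)%N ->
     ~~ (p %| d * (A + m) + 1)%N) ->
  (\sum_(0 <= m < N | Q m) 1)%:R * selberg_sum R Z d
    <= N%:R + (Z ^ 4)%:R * selberg_sum R Z d.
Proof.
move=> d0 Z0 QP; set S := selberg_sum R Z d.
have S1 : 1 <= S by exact: selberg_sum_ge1.
have S0 : 0 < S by exact: lt_le_trans S1.
pose h m (p : 'I_Z.+1) : R := 1 - p%:R * (p %| d * (A + m) + 1)%:R.
pose phi (G : {set 'I_Z.+1}) : R := \prod_(p in G) p.-1%:R.
have phi0 G : 0 <= phi G by exact: prodr_ge0.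
pose F m : R := \sum_(G in sieve_family Z d) (phi G)^-1 * \prod_(p in G) h m p.
rewrite -(ler_pM2r S0).
apply: (@le_trans _ _ (\sum_(0 <= m < N) F m ^+ 2)).
  rewrite -mulrA -expr2 natr_sum mulr_suml big_mkcond/=; apply: ler_sum => m _.
  case: ifP => Qm; last exact: sqr_ge0.
  rewrite mul1r /F (eq_bigr (fun G => (phi G)^-1)) ?lexx// => G /sieve_familyP[GP _].
  rewrite big1 ?mulr1// => p /GP[p_pr pd].
  by rewrite /h (negbTE (QP _ _ Qm p_pr _ pd)) ?mulr0 ?subr0// -ltnS.
have -> : \sum_(0 <= m < N) F m ^+ 2 =
    \sum_(G in sieve_family Z d) \sum_(H in sieve_family Z d)
      (phi G)^-1 * (phi H)^-1 * \sum_(0 <= m < N) (\prod_(p in G) h m p) * (\prod_(p in H) h m p).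
  under eq_bigr => m _ do rewrite expr2 big_distrlr/=.
  rewrite exchange_big/=; apply: eq_bigr => G _.
  rewrite exchange_big/=; apply: eq_bigr => H _.
  by rewrite mulr_sumr; apply: eq_bigr => m _; ring.
apply: (@le_trans _ _ (\sum_(G in sieve_family Z d) \sum_(H in sieve_family Z d)
      (phi G)^-1 * (phi H)^-1 * ((G == H)%:R * N%:R * phi G + (Z ^ 4)%:R))).
  apply: ler_sum => G GS; apply: ler_sum => H HS; apply: ler_wpM2l.
    by rewrite mulr_ge0 ?invr_ge0.
  exact: sieve_correlation.
have SE : \sum_(G in sieve_family Z d) (phi G)^-1 = S by [].
have -> : (N%:R + (Z ^ 4)%:R * S) * S =
    \sum_(G in sieve_family Z d) ((phi G)^-1 * N%:R + (phi G)^-1 * S * (Z ^ 4)%:R).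
  rewrite big_split/= -!mulr_suml SE; ring.
apply: ler_sum => G GS.
under eq_bigr => H _ do rewrite mulrDr.
rewrite big_split/= -mulr_suml -mulr_sumr SE lerD2r (bigD1 G)//= eqxx mul1r big1; last first.
  by move=> H /andP[_ /negbTE]; rewrite eq_sym => -> /=; ring.
have [->|pG] := eqVneq (phi G) 0; first by rewrite invr0 !mul0r addr0.
by rewrite le_eqVlt; apply/orP; left; apply/eqP; field.
Qed.

(** * Lower bound for the Selberg sum *)

(** For square-free [d] this is sigma(d) / d. It measures the loss from sieving only by primes that
    do not divide [d]. *)
Definition sigma_ratio (R : realFieldType) (d : nat) : R :=
  \prod_(q <- primes d) (1 + q%:R^-1).

Lemma sigma_ratio_ge1 (R : realFieldType) (d : nat) : 1 <= sigma_ratio R d.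
Proof.
by apply: (big_ind (fun x : R => 1 <= x)) => // [x y|q _]; [exact: mulr_ege1 | rewrite lerDl].
Qed.

Lemma big_sub_seq (T I : eqType) (x0 : T) (op : Monoid.com_law x0) (s t : seq I) (F : I -> T) :
  uniq s -> uniq t -> {subset s <= t} ->
  \big[op/x0]_(i <- t) F i = op (\big[op/x0]_(i <- s) F i) (\big[op/x0]_(i <- t | i \notin s) F i).
Proof.
move=> us ut st; rewrite (bigID (mem s))/=; congr (op _ _).
rewrite -big_filter; apply: perm_big; apply: uniq_perm => //; first exact: filter_uniq.
move=> i; rewrite mem_filter; apply: andb_idr; exact: st.
Qed.

Lemma ler_sum_sub_seq (R : realFieldType) (I : eqType) (s t : seq I) (F : I -> R) :
  uniq s -> uniq t -> {subset s <= t} -> (forall i, 0 <= F i) ->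
  \sum_(i <- s) F i <= \sum_(i <- t) F i.
Proof.
move=> us ut st F0; rewrite [leRHS](@big_sub_seq _ _ _ _ s)//= lerDl.
exact: sumr_ge0.
Qed.

Lemma ler_prod_sub_seq (R : realFieldType) (I : eqType) (s t : seq I) (F : I -> R) :
  uniq s -> uniq t -> {subset s <= t} -> (forall i, 1 <= F i) ->
  \prod_(i <- s) F i <= \prod_(i <- t) F i.
Proof.
move=> us ut st F1; rewrite [leRHS](@big_sub_seq _ _ _ _ s)//= ler_peMr//.
  by apply: prodr_ge0 => i _; exact: le_trans (F1 i).
by apply: (big_ind (fun x : R => 1 <= x)) => // x y; exact: mulr_ege1.
Qed.

Lemma sigma_ratio_dvdn (R : realFieldType) (d M : nat) : (0 < M)%N -> (d %| M)%N ->
  sigma_ratio R d <= sigma_ratio R M.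
Proof.
move=> M0 dM; apply: ler_prod_sub_seq; rewrite ?primes_uniq//.
  move=> q; rewrite !mem_primes => /and3P[-> d0 qd] /=.
  by rewrite M0 (dvdn_trans qd).
by move=> q; rewrite lerDl.
Qed.

Lemma big_pos_ord (R : Type) (x0 : R) (op : Monoid.law x0) (n : nat) (P : pred nat) (F : nat -> R) :
  \big[op/x0]_(k < n | (0 < k)%N && P k) F k = \big[op/x0]_(1 <= k < n | P k) F k.
Proof.
rewrite -(big_mkord (fun k => (0 < k)%N && P k) F) (@big_nat_widenl _ _ _ 1 0)//.
by apply: eq_bigl => k; rewrite andbC.
Qed.

(** Every [n] up to [Z] is a square-free divisor of [d] times a member of the sieve family times a
    square. The harmonic sum is thus at most a product of three sums of reciprocals; in the second,
    1/p is enlarged to 1/(p - 1). *)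
Lemma selberg_sum_ge (R : realFieldType) (Z d : nat) : (0 < d)%N ->
  \sum_(1 <= n < Z.+1) n%:R^-1 <= 2 * sigma_ratio R d * selberg_sum R Z d.
Proof.
move=> d0.
pose D := [set p : 'I_Z.+1 | prime p && (p %| d)%N].
pose Q (j : {set 'I_Z.+1} * ({set 'I_Z.+1} * 'I_Z.+1)) :=
  (j.1 \subset D) && ((j.2.1 \in sieve_family Z d) && (0 < j.2.2)%N).
pose v (j : {set 'I_Z.+1} * ({set 'I_Z.+1} * 'I_Z.+1)) :=
  (\prod_(p in j.1) p * (\prod_(p in j.2.1) p * j.2.2 ^ 2))%N.
apply: (@le_trans _ _ (\sum_(j | Q j) (v j)%:R^-1)).
  apply: (@sum_le_cover R _ _ (index_iota 1 Z.+1) Q v (fun n => n%:R^-1)) => //.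
    exact: iota_uniq.
  move=> n; rewrite mem_index_iota => nZ.
  have [G [k [GP k0 nE]]] := @squarefree_square_decomposition Z n nZ.
  exists (G :&: D, (G :\: D, k)).
    apply/andP; split; first exact: subsetIr.
    rewrite /= k0 andbT; apply/andP; split.
      apply/fintype.subsetP => p /setDP[pG]; rewrite !inE => /negP pD.
      by rewrite GP//=; apply/negP => pd; apply: pD; rewrite GP.
    have : (n <= Z)%N by lia.
    apply: leq_trans; rewrite nE [X in (_ <= X * _)%N](big_setID D)/= mulnAC; apply: leq_pmull.
    rewrite muln_gt0 expn_gt0 k0 andbT; apply: prodn_cond_gt0 => p /setIP[/GP/prime_gt0]//.
  by rewrite /v/= nE [in RHS](big_setID D)/= mulnA.
have -> : \sum_(j | Q j) (v j)%:R^-1 =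
    (\sum_(G : {set 'I_Z.+1} | G \subset D) \prod_(p in G) p%:R^-1) *
    ((\sum_(G in sieve_family Z d) (\prod_(p in G) p%:R)^-1) *
     (\sum_(k : 'I_Z.+1 | (0 < k)%N) (k%:R ^+ 2)^-1)) :> R.
  rewrite -[X in _ * X]mul_sum_pair -mul_sum_pair; apply: eq_bigr => j _.
  by rewrite /v natrM invfM natrM invfM natrX !natr_prod prodfV.
have h1 : \sum_(G : {set 'I_Z.+1} | G \subset D) \prod_(p in G) p%:R^-1 <= sigma_ratio R d.
  rewrite sum_subset_prod.
  rewrite -big_enum/= -(big_map val xpredT (fun q : nat => 1 + q%:R^-1 : R)).
  apply: ler_prod_sub_seq; rewrite ?primes_uniq//.
  - by rewrite map_inj_uniq ?enum_uniq//; exact: val_inj.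
  - move=> q /mapP[p]; rewrite mem_enum inE => /andP[p_pr pd] ->.
    by rewrite mem_primes p_pr d0.
  - by move=> q; rewrite lerDl.
have h2 : \sum_(G in sieve_family Z d) (\prod_(p in G) p%:R)^-1 <= selberg_sum R Z d.
  apply: ler_sum => G /sieve_familyP[GP _].
  have pos (p : 'I_Z.+1) : p \in G -> 0 < p.-1%:R :> R.
    by move=> /GP[/prime_gt1 p1 _]; rewrite ltr0n; lia.
  rewrite lef_pV2 ?posrE; first by apply: ler_prod => p /pos/ltW ->; rewrite ler_nat leq_pred.
    by apply: prodr_gt0 => p /GP[/prime_gt0 p0 _]; rewrite ltr0n.
  by apply: prodr_gt0 => p /pos.
have h3 : \sum_(k : 'I_Z.+1 | (0 < k)%N) (k%:R ^+ 2)^-1 <= 2 :> R.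
  apply: le_trans (sum_inv_sqr_le2 R Z).
  rewrite -(big_pos_ord _ _ xpredT (fun k => (k%:R ^+ 2)^-1 : R)).
  by under eq_bigl do rewrite -(andbT (0 < _)%N).
rewrite (mulrC 2) -mulrA (mulrC 2).
apply: ler_pM => //.
- by apply: sumr_ge0 => G _; apply: prodr_ge0.
- by apply: mulr_ge0; apply: sumr_ge0 => i _; rewrite ?invr_ge0 ?prodr_ge0// exprn_ge0.
apply: ler_pM => //; apply: sumr_ge0 => i _; rewrite ?invr_ge0 ?prodr_ge0// exprn_ge0//.
Qed.

Lemma harmonic_ge (R : realFieldType) (b : nat) :
  1 + b%:R / 2 <= \sum_(1 <= n < (2 ^ b).+1) n%:R^-1 :> R.
Proof.
elim: b => [|b IH]; first by rewrite big_nat1 mul0r addr0 invr1.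
have p0 : (0 < 2 ^ b)%N by rewrite expn_gt0.
rewrite (@big_cat_nat _ _ _ (2 ^ b).+1)//=; last by rewrite ltnS leq_exp2l.
rewrite -natr1 mulrDl addrA; apply: lerD => //.
apply: (@le_trans _ _ (\sum_((2 ^ b).+1 <= n < (2 ^ b.+1).+1) (2 ^ b.+1)%:R^-1)).
  rewrite sumr_const_nat subSS expnS mul2n -addnn addnK addnn -mul2n natrM invfM.
  by rewrite -[X in _ <= X]mulr_natr mulfVK ?pnatr_eq0 -?lt0n// mul1r.
apply: ler_sum_nat => n /andP[n1 n2].
by rewrite lef_pV2 ?posrE ?ltr0n ?expn_gt0// ?ler_nat//; lia.
Qed.

(** * Brun-Titchmarsh bounds on dyadic blocks *)

(** Sieving up to [2 ^ b] with [b] near j/8 keeps the error [Z ^ 4] below the square root of the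
    length [2 ^ j], while the Selberg sum still has order at least [j] divided by [sigma_ratio]. The
    primes counted exceed [2 ^ j], hence survive the sieve. *)
Lemma count_primes_dyadic (R : realFieldType) (d j : nat) : (0 < d)%N ->
  (\sum_(0 <= m < 2 ^ j | prime (d * (2 ^ j + m) + 1)) 1)%:R
    <= 40 * sigma_ratio R d * (2 ^ j)%:R / j.+1%:R.
Proof.
move=> d0; set c : R := (leLHS); set b := (j %/ 8)%N.
have z0 : (0 < 2 ^ b)%N by rewrite expn_gt0.
have bj : (b * 8 <= j)%N by exact: leq_trunc_div.
have bj' : (j.+1 <= 8 * b.+1)%N by have := divn_eq j 8; have := ltn_pmod j (isT : 0 < 8)%N; lia.
have S1 := selberg_sum_ge1 R d z0; set S := selberg_sum _ _ _ in S1.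
have rho1 := sigma_ratio_ge1 R d; set rho := sigma_ratio _ _ in rho1 *.
have Sge : 1 + b%:R / 2 <= 2 * rho * S.
  exact: le_trans (harmonic_ge R b) (selberg_sum_ge _ _ d0).
have sieve : c * S <= (2 ^ j)%:R + ((2 ^ b) ^ 4)%:R * S.
  apply: (@selberg_sieve R _ d (2 ^ j) (2 ^ j) (fun m => prime (d * (2 ^ j + m) + 1))) => //.
  move=> m p pr p_pr pz pd; rewrite dvdn_prime2//; apply/eqP => pE.
  have : (2 ^ b <= 2 ^ j)%N by rewrite leq_exp2l//; lia.
  by nia.
have z4 : ((2 ^ b) ^ 4)%:R * j.+1%:R <= 8 * (2 ^ j)%:R :> R.
  rewrite -!natrM ler_nat -expnM; apply: (@leq_trans (2 ^ (b * 4) * (8 * 2 ^ (b * 4)))).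
    rewrite leq_mul2l; apply/orP; right; apply: (leq_trans bj'); rewrite leq_mul2l/=.
    have := ltn_expl b (isT : 1 < 2)%N; have : (2 ^ b <= 2 ^ (b * 4))%N by rewrite leq_exp2l//; lia.
    by lia.
  by rewrite mulnCA leq_mul2l/= -expnD leq_exp2l//; lia.
have J0 : 0 < j.+1%:R :> R by rewrite ltr0n.
have S0 : 0 < S by apply: lt_le_trans S1.
rewrite ler_pdivlMr// -(ler_pM2r S0).
have jb : j.+1%:R <= 8 * (b%:R + 1) :> R.
  by rewrite natr1 -natrM ler_nat.
set T : R := (2 ^ j)%:R in sieve z4 *; set z : R := ((2 ^ b) ^ 4)%:R in sieve z4.
have T0 : 0 <= T by [].
(* The constant 40 is 32 from the main term here plus 8 from the sieve error [z4]. *)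
have jS : j.+1%:R <= 32 * rho * S by nra.
have := ler_wpM2r (ltW J0) sieve.
have := ler_wpM2l T0 jS.
have := ler_wpM2r (ltW S0) z4.
have : T * S <= rho * (T * S) by rewrite ler_peMl// mulr_ge0// ltW.
by lra.
Qed.

Lemma sum_inv_primes_AP_dyadic (R : realFieldType) (d J : nat) : (0 < d)%N ->
  \sum_(1 <= m < 2 ^ J | prime (d * m + 1)) (d * m + 1)%:R^-1
    <= 40 * sigma_ratio R d / d%:R * \sum_(0 <= j < J) j.+1%:R^-1.
Proof.
move=> d0; have d0' : 0 < d%:R :> R by rewrite ltr0n.
elim: J => [|J IH]; first by rewrite !big_geq// mulr0.
have p0 : (0 < 2 ^ J)%N by rewrite expn_gt0.
rewrite (@big_cat_nat _ _ _ (2 ^ J))//=; last by rewrite leq_exp2l.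
rewrite big_nat_recr//= mulrDr; apply: lerD => //.
have p0' : 0 < (2 ^ J)%:R :> R by rewrite ltr0n.
rewrite -{1}[(2 ^ J)%N]add0n big_addn expnS mul2n -addnn addnK.
apply: (@le_trans _ _ (\sum_(0 <= m < 2 ^ J | prime (d * (2 ^ J + m) + 1)) (d%:R * (2 ^ J)%:R)^-1)).
  rewrite (eq_bigl (fun m => prime (d * (2 ^ J + m) + 1))) => [|m]; last by rewrite (addnC m).
  apply: ler_sum => m _.
  by rewrite lef_pV2 ?posrE -?natrM ?ltr0n ?ler_nat ?muln_gt0 ?d0//; nia.
have := count_primes_dyadic R J d0; rewrite natr_sum => H.
rewrite -[X in X <= _]mul1r mulr_sumr.
rewrite (eq_bigr (fun=> 1%:R * (d%:R * (2 ^ J)%:R)^-1)); last by move=> m _; rewrite mul1r.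
rewrite -mulr_suml ler_pdivrMr ?mulr_gt0//; apply: (le_trans H).
rewrite le_eqVlt; apply/orP; left; apply/eqP; field.
by rewrite !gt_eqF//= addrC natr1 ltr0n.
Qed.

(** Writing p = d m + 1 sorts the primes into dyadic blocks of m. For the least admissible [J], the
    harmonic sum on the right plays the role of log log X. *)
Lemma sum_inv_primes_AP (R : realFieldType) (d X J : nat) : (0 < d)%N -> (X < 2 ^ J)%N ->
  \sum_(p <- [seq p <- iota 0 X.+1 | prime p && (d %| p.-1)%N]) p%:R^-1
    <= 40 * sigma_ratio R d / d%:R * \sum_(0 <= j < J) j.+1%:R^-1.
Proof.
move=> d0 XJ; apply: le_trans (sum_inv_primes_AP_dyadic _ _ d0).
rewrite -big_pos_ord.
apply: (@sum_le_cover R _ _ _ _ (fun m : 'I_(2 ^ J) => (d * m + 1)%N) (fun p => p%:R^-1)) => //.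
  by rewrite filter_uniq ?iota_uniq.
move=> p; rewrite mem_filter mem_iota /= => /andP[/andP[p_pr dp] pX].
have p1 := prime_gt1 p_pr.
have mE : (d * (p.-1 %/ d) + 1 = p)%N by rewrite mulnC divnK//; lia.
have mJ : (p.-1 %/ d < 2 ^ J)%N by have := leq_div p.-1 d; lia.
exists (Ordinal mJ) => //=; rewrite mE p_pr andbT divn_gt0// dvdn_leq//; lia.
Qed.

(** * Sums over sets of primes *)

Lemma sum_exp_terms_le (R : realType) (S : R) (n : nat) : 0 <= S ->
  \sum_(0 <= k < n) S ^+ k / k`!%:R <= expR S.
Proof.
move=> S0.
have := @nondecreasing_cvgn_le R (series (exp_coeff S)) _ (is_cvg_series_exp_coeff S) n.
apply; apply: (@nondecreasing_series _ _ xpredT) => k _ _; exact: exp_coeff_ge0.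
Qed.

(* Counting the pairs (G, i) with i in G and |G| = k in two ways bounds the sum
   over k-sets by V(set0) S^k / k!. *)
Lemma sum_sets_le_exp (R : realType) (I : finType) (V : {set I} -> R) (S : R) :
  0 <= S -> (forall G, 0 <= V G) ->
  (forall G : {set I}, \sum_(i | i \notin G) V (i |: G) <= S * V G) ->
  \sum_G V G <= V set0 * expR S.
Proof.
move=> S0 V0 HV.
pose T k := \sum_(G : {set I} | #|G| == k) V G.
have T0 : T 0%N = V set0.
  rewrite /T (bigD1 set0) ?cards0//= big1 ?addr0// => G /andP[].
  by rewrite cards_eq0 => /eqP ->; rewrite eqxx.
have TS k : k.+1%:R * T k.+1 <= S * T k.
  have -> : k.+1%:R * T k.+1 = \sum_i \sum_(G : {set I} | (#|G| == k.+1) && (i \in G)) V G.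
    rewrite [RHS](exchange_big_dep (fun G : {set I} => #|G| == k.+1))/= => [|i G _ /andP[]//].
    rewrite /T mulr_sumr.
    apply: eq_bigr => G /eqP Gk; rewrite (eq_bigl (fun i => i \in G)); last first.
      by move=> i; rewrite Gk eqxx.
    by rewrite sumr_const Gk mulr_natl.
  have -> : \sum_i \sum_(G : {set I} | (#|G| == k.+1) && (i \in G)) V G =
      \sum_i \sum_(G : {set I} | (#|G| == k) && (i \notin G)) V (i |: G).
    apply: eq_bigr => i _.
    rewrite (reindex_onto (fun G => i |: G) (fun G => G :\ i))/=; last first.
      by move=> G /andP[_ iG]; exact: setD1K.
    apply: eq_bigl => G; rewrite setU11 andbT.
    have [iG|iG] := boolP (i \in G); last by rewrite setU1K// eqxx cardsU1 iG andbT.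
    rewrite andbF; apply/negP => /andP[_ /eqP e].
    by move: iG; rewrite -e setD11.
  rewrite (exchange_big_dep (fun G : {set I} => #|G| == k))/= => [|i G _ /andP[]//].
  rewrite /T mulr_sumr; apply: ler_sum => G /eqP Gk.
  rewrite (eq_bigl (fun i => i \notin G)); last by move=> i; rewrite Gk eqxx.
  exact: HV.
have Tk k : T k <= V set0 * (S ^+ k / k`!%:R).
  elim: k => [|k IH]; first by rewrite T0 expr0 fact0 divr1 mulr1.
  have k0 : 0 < k.+1%:R :> R by rewrite ltr0n.
  rewrite -(ler_pM2l k0); apply: (le_trans (TS k)).
  apply: (le_trans (ler_wpM2l S0 IH)).
  rewrite factS natrM exprS le_eqVlt; apply/orP; left; apply/eqP; field.
  by rewrite pnatr_eq0 -lt0n fact_gt0 addrC natr1 gt_eqF.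
have -> : \sum_G V G = \sum_(0 <= k < #|I|.+1) T k.
  rewrite big_mkord /T (partition_big (fun G : {set I} => inord #|G| : 'I_#|I|.+1) xpredT)//=.
  apply: eq_bigr => k _; apply: eq_bigl => G; rewrite -val_eqE/= inordK//.
  by rewrite ltnS max_card.
apply: (@le_trans _ _ (V set0 * \sum_(0 <= k < #|I|.+1) S ^+ k / k`!%:R)).
  by rewrite mulr_sumr; apply: ler_sum => k _; exact: Tk.
by apply: ler_wpM2l => //; exact: sum_exp_terms_le.
Qed.

(** A truncated Euler product, built one prime [q] at a time: the terms divisible by [q] are [g q]
    times terms at [n %/ q], which is again in range. The full sum T thus satisfies T <= T' + [g q]
    T, where T' omits [q]. *)
Lemma sum_smooth_le (R : realFieldType) (g : nat -> R) (ps : seq nat) (N : nat) :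
  (forall m n, g (m * n)%N = g m * g n) -> g 1%N = 1 -> (forall n, 0 <= g n) ->
  all prime ps -> {in ps, forall p, g p < 1} ->
  \sum_(n <- [seq n <- iota 1 N | all (mem ps) (primes n)]) g n
    <= \prod_(p <- ps) (1 - g p)^-1.
Proof.
move=> gM g1 g0; elim: ps => [|q ps IH].
  move=> _ _; rewrite big_nil -[leRHS]g1.
  apply: (@le_trans _ _ (\sum_(i < 1) g 1%N)); last by rewrite big_ord1.
  apply: (@sum_le_cover R _ 'I_1 _ xpredT (fun=> 1%N) g); rewrite ?filter_uniq ?iota_uniq//.
  move=> n; rewrite mem_filter mem_iota => /andP[/allP h /andP[n1 _]]; exists ord0 => //.
  apply/eqP; rewrite eq_sym eqn_leq n1 andbT leqNgt; apply/negP => n2.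
  by have := h (pdiv n); rewrite mem_primes pdiv_prime// pdiv_dvd n1 => /(_ isT).
move=> /= /andP[q_pr ps_pr] gps.
have gq : g q < 1 by apply: gps; rewrite mem_head.
have {}IH := IH ps_pr (fun p pps => gps p (mem_behead (s := q :: ps) pps)).
rewrite big_cons mulrC ler_pdivlMr ?subr_gt0//.
apply: le_trans IH; set T := \sum_(_ <- _) _; rewrite mulrBr mulr1 lerBlDr.
rewrite {1}/T (bigID (fun n => (q %| n)%N))/= addrC; apply: lerD.
  rewrite -big_filter; apply: ler_sum_sub_seq; rewrite ?filter_uniq ?iota_uniq//.
  move=> n; rewrite !mem_filter => /andP[qn /andP[/allP h ->]]; rewrite andbT.
  apply/allP => p pn; have := h p pn; rewrite inE => /predU1P[pq|//].
  by move: pn qn; rewrite pq mem_primes => /and3P[_ _ ->].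
rewrite /T mulr_suml; rewrite -[leLHS]big_filter.
set r := [seq n <- iota 1 N | _].
apply: (@le_trans _ _ (\sum_(n < N.+1 | val n \in r) g (q * n)%N)).
  apply: (@sum_le_cover R _ _ _ (fun n : 'I_N.+1 => val n \in r) (fun n : 'I_N.+1 => (q * n)%N) g) => //.
    by rewrite !filter_uniq ?iota_uniq.
  move=> n; rewrite mem_filter => /andP[qn]; rewrite mem_filter mem_iota => /andP[/allP h nN].
  have nq : (n %/ q <= n)%N by exact: leq_div.
  have n0 : (0 < n %/ q)%N by rewrite divn_gt0 ?prime_gt0// dvdn_leq//; lia.
  have nq' : (n %/ q < N.+1)%N by lia.
  exists (Ordinal nq') => /=; last by rewrite mulnC divnK.
  rewrite mem_filter mem_iota; apply/andP; split; last by lia.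
  apply/allP => p; rewrite mem_primes => /and3P[p_pr _ pn]; apply: h.
  by rewrite mem_primes p_pr (dvdn_trans pn) ?dvdn_div//; lia.
under eq_bigr => n _ do rewrite gM mulrC.
rewrite -(big_mkord (fun n => n \in r) (fun n => g n * g q)) -big_filter.
apply: ler_sum_sub_seq; rewrite ?filter_uniq ?iota_uniq//.
- by move=> n; rewrite mem_filter => /andP[].
- by move=> n; rewrite mulr_ge0.
Qed.

Lemma sum_divisors_le (R : realType) (g : nat -> R) (M : nat) : (0 < M)%N ->
  (forall m n, g (m * n)%N = g m * g n) -> g 1%N = 1 -> (forall n, 0 <= g n) ->
  (forall p, prime p -> g p <= 3 / 4) ->
  \sum_(d <- divisors M) g d <= expR (4 * \sum_(p <- primes M) g p).
Proof.
move=> M0 gM g1 g0 g34.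
have g34' p : p \in primes M -> g p <= 3 / 4.
  by rewrite mem_primes => /andP[/g34].
apply: (@le_trans _ _ (\prod_(p <- primes M) (1 - g p)^-1)).
  apply: le_trans (@sum_smooth_le R g (primes M) M gM g1 g0 _ _).
  - apply: ler_sum_sub_seq; rewrite ?divisors_uniq ?filter_uniq ?iota_uniq//.
    move=> d; rewrite -dvdn_divisors// => dM; rewrite mem_filter mem_iota.
    have d0 := dvdn_gt0 M0 dM; have := dvdn_leq M0 dM => dM'.
    apply/andP; split; last by lia.
    apply/allP => p; rewrite mem_primes => /and3P[p_pr _ pd].
    by rewrite /= mem_primes p_pr M0 (dvdn_trans pd).
  - by apply/allP => p; rewrite mem_primes => /andP[].
  - by move=> p /g34'; lra.
rewrite mulr_sumr expR_sum big_seq [leRHS]big_seq; apply: ler_prod => p /g34' gp.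
have gp0 := g0 p; have p1 : 0 < 1 - g p by lra.
rewrite invr_ge0 (ltW p1)/= -[leLHS]mul1r ler_pdivrMr//.
(* The bound 3/4 enters through (1 + 4 g)(1 - g) - 1 = g (3 - 4 g). *)
apply: (@le_trans _ _ ((1 + 4 * g p) * (1 - g p))); first by nra.
by rewrite ler_pM2r// expR_ge1Dx.
Qed.

Lemma sum_inv_sqrt_le (R : realType) (U V : nat) : (0 < U)%N ->
  \sum_(U <= n < V) (n.+1%:R * Num.sqrt n.+1%:R)^-1 <= 2 / Num.sqrt U%:R :> R.
Proof.
move=> U0; have [VU|UV] := leqP V U; first by rewrite big_geq// divr_ge0// sqrtr_ge0.
suff H : \sum_(U <= n < V) (n.+1%:R * Num.sqrt n.+1%:R)^-1 <=
    2 / Num.sqrt U%:R - 2 / Num.sqrt V%:R :> R.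
  by apply: (le_trans H); rewrite gerBl divr_ge0// sqrtr_ge0.
have := telescope_sumr (fun n => - (2 / Num.sqrt n%:R) : R) (ltnW UV).
rewrite opprK addrC => <-.
apply: ler_sum_nat => n /andP[Un _].
rewrite opprK addrC; set a : R := Num.sqrt n%:R; set b : R := Num.sqrt n.+1%:R.
have a0 : 0 < a by rewrite sqrtr_gt0 ltr0n; lia.
have ab : a <= b by rewrite ler_sqrt// ler_nat.
have b0 : 0 < b by lra.
have bE : n.+1%:R = b ^+ 2 by rewrite sqr_sqrtr.
have aE : n%:R = a ^+ 2 by rewrite sqr_sqrtr.
have e : b ^+ 2 = a ^+ 2 + 1 by rewrite -bE -aE natr1.
rewrite bE -subr_ge0.
have -> : 2 / a - 2 / b - (b ^+ 2 * b)^-1 = (2 * b ^+ 2 * (b - a) - a) / (a * b ^+ 3).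
  by field; rewrite !gt_eqF.
apply: divr_ge0; last by rewrite mulr_ge0 ?exprn_ge0 ?ltW.
have : (b - a) * (b + a) = 1 by rewrite -subr_sqr e; ring.
nra.
Qed.

Lemma ler_sum_widen (R : realFieldType) (I : Type) (r : seq I) (P Q : pred I) (F : I -> R) :
  (forall i, P i -> Q i) -> (forall i, 0 <= F i) ->
  \sum_(i <- r | P i) F i <= \sum_(i <- r | Q i) F i.
Proof.
move=> PQ F0; rewrite [leLHS]big_mkcond [leRHS]big_mkcond; apply: ler_sum => i _.
by case: ifP => [/PQ ->//|_]; case: ifP.
Qed.

Lemma prod_primes_dvdn (l : seq nat) (n : nat) : uniq l -> all prime l ->
  all (dvdn^~ n) l -> (\prod_(p <- l) p %| n)%N.
Proof.
elim: l => [|p l IH]; first by rewrite big_nil dvd1n.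
rewrite /= big_cons => /andP[pl ul] /andP[p_pr lp] /andP[pn ln].
rewrite Gauss_dvd ?pn ?IH// prime_coprime//; apply/negP => pd.
move: pl => /negP; apply; move: pd lp {ul IH ln}.
elim: l => [|q l IH]; first by rewrite big_nil dvdn1 => /eqP p1; rewrite p1 in p_pr.
rewrite big_cons Euclid_dvdM// inE => /orP[pq|/IH H] /= /andP[q_pr l_pr].
  by rewrite -(dvdn_prime2 p_pr q_pr) pq.
by rewrite H ?orbT.
Qed.

Lemma primes_prod_sub (l : seq nat) : all prime l -> {subset primes (\prod_(p <- l) p) <= l}.
Proof.
move=> lp p; rewrite mem_primes => /and3P[p_pr _].
elim: l lp => [|q l IH]; first by rewrite big_nil dvdn1 => _ /eqP p1; rewrite p1 in p_pr.
rewrite /= big_cons Euclid_dvdM// inE => /andP[q_pr l_pr] /orP[pq|/IH H].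
  by rewrite -(dvdn_prime2 p_pr q_pr) pq.
by rewrite H ?orbT.
Qed.

(** * Large prime factors of p - 1 and the exceptional sets *)

Definition prime_set (X : nat) : {set 'I_X.+1} := [set p : 'I_X.+1 | prime p].

Definition rough_set (R : realType) (X : nat) (u : R) (p : nat) : {set 'I_X.+1} :=
  [set q : 'I_X.+1 | [&& prime q, (q %| p.-1)%N & u < q%:R]].

Definition rough_weight (R : realType) (X : nat) (u : R) (p : nat) : R :=
  \sum_(q in rough_set X u p) (Num.sqrt q%:R)^-1.

Lemma rough_weight_ge0 (R : realType) (X : nat) (u : R) (p : nat) :
  0 <= rough_weight X u p.
Proof. by apply: sumr_ge0 => q _; rewrite invr_ge0 sqrtr_ge0. Qed.

Lemma expR_le1D3x (R : realType) (t : R) : 0 <= t <= 1 -> expR t <= 1 + 3 * t.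
Proof.
move=> /andP[t0 t1]; have := expR_ge1Dx (- (t / 2)); set e := expR (- _) => e1.
have e0 : 0 < e by exact: expR_gt0.
have te : expR t * e ^+ 2 = 1.
  by rewrite -expRM_natl -expRD (_ : t + _ = 0) ?expR0//; field.
have te0 : 0 < expR t by exact: expR_gt0.
have e2 : (1 - t / 2) ^+ 2 <= e ^+ 2.
  by rewrite lerXn2r ?nnegrE//; lra.
have h1 : 1 <= (1 + 3 * t) * (1 - t / 2) ^+ 2.
  rewrite -subr_ge0 (_ : _ - 1 = t * ((1 - t) * (2 - 3 / 4 * t))); last by field.
  by rewrite !mulr_ge0//; lra.
have h2 : 1 <= (1 + 3 * t) * e ^+ 2.
  by apply: (le_trans h1); apply: ler_wpM2l => //; lra.
by rewrite -(ler_pM2r (exprn_gt0 2 e0)) te.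
Qed.

(** The tail of the series of q^(-3/2) beyond u has order u^(-1/2), which the factor [Num.sqrt u]
    cancels; rounding u down costs at most a factor 2. *)
Lemma sum_rough_inv_sqrt (R : realType) (X : nat) (u : R) : 1 <= u ->
  \sum_(q : 'I_X.+1 | u < q%:R) Num.sqrt u / (q%:R * Num.sqrt q%:R) <= 4 :> R.
Proof.
move=> u1; rewrite -mulr_sumr.
have u0 : 0 <= u by lra.
have /andP[Uu uU] := truncn_itv u0; set U := Num.truncn u in Uu uU.
have U0 : (0 < U)%N by rewrite truncn_gt0.
have U0' : 0 < Num.sqrt U%:R :> R by rewrite sqrtr_gt0 ltr0n.
have H : \sum_(q : 'I_X.+1 | u < q%:R) (q%:R * Num.sqrt q%:R)^-1 <= 2 / Num.sqrt U%:R :> R.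
  apply: le_trans (sum_inv_sqrt_le R X U0).
  rewrite -(big_mkord (fun q => u < q%:R) (fun q => (q%:R * Num.sqrt q%:R)^-1 : R)).
  have -> : \sum_(U <= n < X) (n.+1%:R * Num.sqrt n.+1%:R)^-1 =
      \sum_(U.+1 <= q < X.+1) (q%:R * Num.sqrt q%:R)^-1 :> R by rewrite big_add1.
  rewrite [leRHS](@big_nat_widenl _ _ _ U.+1 0)//=; apply: ler_sum_widen.
    by move=> q uq; rewrite -(ltr_nat R); exact: le_lt_trans Uu uq.
  by move=> q; rewrite invr_ge0 mulr_ge0// sqrtr_ge0.
apply: (le_trans (ler_wpM2l (sqrtr_ge0 _) H)).
rewrite mulrA ler_pdivrMr//.
have : Num.sqrt u <= 2 * Num.sqrt U%:R.
  rewrite -(@ler_pXn2r _ 2)// ?nnegrE ?sqrtr_ge0 ?mulr_ge0 ?sqrtr_ge0//.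
  rewrite exprMn !sqr_sqrtr//; have : 1 <= U%:R :> R by rewrite (ler_nat R 1).
  by rewrite -natr1 in uU; lra.
lra.
Qed.

(** Each factor exp (sqrt (u / q)) has exponent at most 1, hence is at most 1 + 3 sqrt (u / q).
    Expanding over sets [D] of primes q leaves sums of 1/p over p = 1 modulo the product of [D]; the
    bounds for these resum to an Euler product over all q > u. *)
Lemma rough_moment (R : realType) (X J : nat) (u : R) : 1 <= u -> (X < 2 ^ J)%N ->
  \sum_(p in prime_set X) p%:R^-1 * expR (Num.sqrt u * rough_weight X u p)
    <= 40 * expR 24 * \sum_(0 <= j < J) j.+1%:R^-1.
Proof.
move=> u1 XJ; set HJ := \sum_(0 <= j < J) _.
have u0 : 0 <= u by lra.
have HJ0 : 0 <= HJ by exact: sumr_ge0.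
pose w (q : 'I_X.+1) : R := 3 * (Num.sqrt u / Num.sqrt q%:R).
have w0 q : 0 <= w q by rewrite mulr_ge0// divr_ge0 ?sqrtr_ge0.
pose Pu := [set q : 'I_X.+1 | prime q && (u < q%:R)].
have step1 (p : nat) : expR (Num.sqrt u * rough_weight X u p) <=
    \sum_(D : {set 'I_X.+1} | D \subset rough_set X u p) \prod_(q in D) w q.
  rewrite sum_subset_prod mulr_sumr expR_sum; apply: ler_prod => q.
  rewrite inE => /and3P[_ _ uq]; rewrite expR_ge0/=; apply: expR_le1D3x.
  have q0 : 0 < Num.sqrt q%:R :> R by rewrite sqrtr_gt0; lra.
  by rewrite divr_ge0 ?sqrtr_ge0//= ler_pdivrMr// mul1r ler_sqrt ltW//; lra.
apply: (@le_trans _ _ (\sum_(p in prime_set X)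
    \sum_(D : {set 'I_X.+1} | D \subset rough_set X u p) p%:R^-1 * \prod_(q in D) w q)).
  by apply: ler_sum => p _; rewrite -mulr_sumr; apply: ler_wpM2l; rewrite ?invr_ge0.
rewrite (exchange_big_dep (fun D : {set 'I_X.+1} => D \subset Pu))/=; last first.
  move=> p D _ /fintype.subsetP DS; apply/fintype.subsetP => q /DS.
  by rewrite !inE => /and3P[-> _ ->].
apply: (@le_trans _ _ (\sum_(D : {set 'I_X.+1} | D \subset Pu)
   (40 * HJ) * \prod_(q in D) (6 * (Num.sqrt u / (q%:R * Num.sqrt q%:R))))).
  apply: ler_sum => D /fintype.subsetP DP.
  have Dpr q : q \in D -> prime q by move=> /DP; rewrite inE => /andP[].
  pose l := [seq val q | q <- enum D].
  have lE : (\prod_(q in D) q = \prod_(q <- l) q)%N by rewrite big_map big_enum.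
  have ul : uniq l by rewrite map_inj_uniq ?enum_uniq//; exact: val_inj.
  have l_pr : all prime l.
    by apply/allP => q /mapP[q']; rewrite mem_enum => /Dpr ? ->.
  set d := (\prod_(q in D) q)%N in lE.
  have d0 : (0 < d)%N by apply: prodn_cond_gt0 => q /Dpr/prime_gt0.
  rewrite -mulr_suml.
  apply: (@le_trans _ _ ((40 * sigma_ratio R d / d%:R * HJ) * \prod_(q in D) w q)).
    apply: ler_wpM2r; first by rewrite prodr_ge0.
    apply: le_trans (sum_inv_primes_AP R d0 XJ).
    rewrite big_filter -[iota 0 X.+1]/(index_iota 0 X.+1) big_mkord; apply: ler_sum_widen; last by [].
    move=> p /andP[]; rewrite inE => -> /fintype.subsetP Dp /=.
    rewrite lE; apply: prod_primes_dvdn => //; apply/allP => q /mapP[q'].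
    by rewrite mem_enum => /Dp; rewrite inE => /and3P[_ ? _] ->.
  (* One factor 2 per prime of [D] turns the 3 in [w] into 6, and 6 times the bound 4 of
     [sum_rough_inv_sqrt] gives the exponent 24. *)
  have sig : sigma_ratio R d <= \prod_(q in D) (2 : R).
    apply: (@le_trans _ _ (\prod_(q <- l) (1 + q%:R^-1))).
      apply: ler_prod_sub_seq; rewrite ?primes_uniq//.
      by rewrite lE; exact: primes_prod_sub.
      by move=> q; rewrite lerDl.
    rewrite big_map big_enum/=; apply: ler_prod => q /Dpr/prime_gt0 q0.
    rewrite addr_ge0 ?invr_ge0//= (_ : 2 = 1 + 1)// lerD2l invf_le1 ?ltr0n//.
    by rewrite (ler_nat R 1).
  have -> : \prod_(q in D) (6 * (Num.sqrt u / (q%:R * Num.sqrt q%:R))) =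
      (\prod_(q in D) 2) * (\prod_(q in D) q%:R^-1) * \prod_(q in D) w q.
    rewrite -!big_split/=; apply: eq_bigr => q _; rewrite /w invfM; ring.
  have -> : \prod_(q in D) q%:R^-1 = d%:R^-1 :> R by rewrite natr_prod prodfV.
  rewrite mulrA; apply: ler_wpM2r; first by rewrite prodr_ge0.
  rewrite (_ : 40 * sigma_ratio R d / d%:R * HJ = 40 * HJ * (sigma_ratio R d / d%:R)); last by ring.
  by apply: ler_wpM2l; [rewrite mulr_ge0 | apply: ler_wpM2r].
rewrite -mulr_sumr sum_subset_prod.
rewrite [40 * HJ]mulrC [leRHS]mulrC mulrA.
apply: ler_wpM2l; first by rewrite mulr_ge0.
apply: (@le_trans _ _ (expR (\sum_(q in Pu) 6 * (Num.sqrt u / (q%:R * Num.sqrt q%:R))))).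
  rewrite expR_sum; apply: ler_prod => q _; rewrite expR_ge1Dx andbT.
  by rewrite addr_ge0// !mulr_ge0// ?invr_ge0 ?mulr_ge0 ?sqrtr_ge0.
rewrite ler_expR -mulr_sumr (_ : 24 = 6 * 4); last by ring.
apply: ler_wpM2l => //; apply: le_trans (sum_rough_inv_sqrt X u1).
apply: ler_sum_widen; first by move=> q; rewrite inE => /andP[].
by move=> q; rewrite divr_ge0 ?mulr_ge0 ?sqrtr_ge0.
Qed.

(** Markov's inequality for the exponential moment: on these sets exp (sqrt u times the total
    weight) exceeds exp (delta u). Once this factor is inserted the condition is dropped, and the
    sum becomes a product over primes. *)
Lemma sum_exceptional (R : realType) (X J : nat) (u delta : R) :
  1 <= u -> (X < 2 ^ J)%N ->
  \sum_(G : {set 'I_X.+1} | (G \subset prime_set X) &&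
      (delta * Num.sqrt u < \sum_(p in G) rough_weight X u p)) \prod_(p in G) p%:R^-1
    <= expR (40 * expR 24 * \sum_(0 <= j < J) j.+1%:R^-1 - delta * u).
Proof.
move=> u1 XJ; have u0 : 0 <= u by lra.
pose v (p : 'I_X.+1) : R := p%:R^-1 * expR (Num.sqrt u * rough_weight X u p).
have v0 p : 0 <= v p by rewrite mulr_ge0 ?invr_ge0 ?expR_ge0.
apply: (@le_trans _ _ (\sum_(G : {set 'I_X.+1} | G \subset prime_set X)
    expR (- (delta * u)) * \prod_(p in G) v p)).
  apply: (@le_trans _ _ (\sum_(G : {set 'I_X.+1} | (G \subset prime_set X) &&
      (delta * Num.sqrt u < \sum_(p in G) rough_weight X u p))
      expR (- (delta * u)) * \prod_(p in G) v p)).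
    apply: ler_sum => G /andP[_ HG].
    rewrite big_split/= -expR_sum mulrCA ler_peMr ?prodr_ge0// -expRD.
    rewrite -expR0 ler_expR -mulr_sumr addrC subr_ge0 -{1}(sqr_sqrtr u0) expr2 mulrA mulrC.
    by apply: ler_wpM2l; rewrite ?sqrtr_ge0// ltW.
  apply: ler_sum_widen; first by move=> G /andP[].
  by move=> G; rewrite mulr_ge0 ?expR_ge0 ?prodr_ge0.
rewrite -mulr_sumr sum_subset_prod addrC expRD; apply: ler_wpM2l; first exact: expR_ge0.
apply: (@le_trans _ _ (expR (\sum_(p in prime_set X) v p))).
  by rewrite expR_sum; apply: ler_prod => p _; rewrite expR_ge1Dx addr_ge0.
by rewrite ler_expR; exact: rough_moment.
Qed.

(** * The lcm of the p - 1 and the sum over non-exceptional sets *)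

Definition lcm_pred (X : nat) (G : {set 'I_X.+1}) : nat :=
  \big[lcmn/1%N]_(p in G) p.-1.

Lemma lcm_pred_gt0 (X : nat) (G : {set 'I_X.+1}) : G \subset prime_set X ->
  (0 < lcm_pred G)%N.
Proof.
move=> /fintype.subsetP GP; rewrite /lcm_pred; apply: (big_ind (fun n : nat => 0 < n)%N) => //.
  by move=> m n; rewrite lcmn_gt0 => -> ->.
by move=> p /GP; rewrite inE => /prime_gt1; lia.
Qed.

Lemma prime_dvdn_lcm_pred (X q : nat) (G : {set 'I_X.+1}) : prime q ->
  (q %| lcm_pred G)%N -> exists2 p, p \in G & (q %| p.-1)%N.
Proof.
move=> q_pr; rewrite /lcm_pred => qG.
have : (q %| \prod_(p in G) p.-1)%N.
  apply: (dvdn_trans qG); apply/dvdn_biglcmP => p pG.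
  by rewrite (bigD1 p)//= dvdn_mulr.
by rewrite Euclid_dvd_prod// big_has_cond => /hasP[p _ /andP[pG qp]]; exists p.
Qed.

(** A prime q > u dividing the lcm divides some p - 1, so it is seen by the rough weight of that p.
    Replacing q^(beta - 1) by q^(-1/2) gains u^(beta - 1/2), since beta <= 1/4. *)
Lemma sum_primes_lcm_pred (R : realType) (X : nat) (u delta beta s : R) (G : {set 'I_X.+1}) :
  1 <= u -> 0 <= beta <= 4^-1 -> G \subset prime_set X ->
  \sum_(q <- [seq q <- iota 0 (Num.truncn u).+1 | prime q]) q%:R `^ (beta - 1) <= s ->
  delta * u `^ beta <= s ->
  \sum_(p in G) rough_weight X u p <= delta * Num.sqrt u ->
  \sum_(q <- primes (lcm_pred G)) q%:R `^ (beta - 1) <= 2 * s.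
Proof.
move=> u1 /andP[b0 b1] GP sm1 sm2 HG; have u0 : 0 < u by lra.
have M0 := lcm_pred_gt0 GP.
rewrite (bigID (fun q : nat => u < q%:R))/= mulrDl mul1r addrC; apply: lerD.
  apply: le_trans sm1; rewrite -big_filter; apply: ler_sum_sub_seq.
  - by rewrite filter_uniq ?primes_uniq.
  - by rewrite filter_uniq ?iota_uniq.
  - move=> q; rewrite !mem_filter mem_primes mem_iota -leNgt => /andP[qu /and3P[-> _ _]].
    by rewrite /= add0n ltnS truncn_ge_nat//; lra.
  - by move=> q; exact: powR_ge0.
apply: le_trans sm2.
apply: (@le_trans _ _ (u `^ (beta - 2^-1) * \sum_(p in G) rough_weight X u p)); last first.
  apply: (le_trans (ler_wpM2l (powR_ge0 _ _) HG)).
  rewrite mulrCA -powR12_sqrt; last exact: ltW.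
  by rewrite -powRD ?subrK ?lexx// (gt_eqF u0) implybT.
apply: (@le_trans _ _ (u `^ (beta - 2^-1) *
    \sum_(q <- [seq q <- primes (lcm_pred G) | u < q%:R]) (Num.sqrt q%:R)^-1)).
  rewrite big_filter mulr_sumr; apply: ler_sum => q uq.
  have q0 : 0 < q%:R :> R by lra.
  rewrite -powR12_sqrt; last exact: ltW.
  rewrite -powRN (_ : beta - 1 = (beta - 2^-1) + - 2^-1); last by field.
  rewrite powRD; last by rewrite (gt_eqF q0) implybT.
  apply: ler_wpM2r; first exact: powR_ge0.
  rewrite -[beta - _]opprB !powRN lef_pV2 ?posrE ?powR_gt0//.
  by apply: ge0_ler_powR; rewrite ?nnegrE ?ltW//; lra.
apply: ler_wpM2l; first exact: powR_ge0.
rewrite /rough_weight pair_big_dep/=.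
apply: (@sum_le_cover R _ _ _ (fun j : 'I_X.+1 * 'I_X.+1 => (j.1 \in G) && (j.2 \in rough_set X u j.1))
   (fun j => val j.2) (fun q => (Num.sqrt q%:R)^-1)).
- by rewrite filter_uniq ?primes_uniq.
- by move=> q; rewrite invr_ge0 sqrtr_ge0.
move=> q; rewrite mem_filter mem_primes => /andP[uq /and3P[q_pr _ qM]].
have [p pG qp] := prime_dvdn_lcm_pred q_pr qM.
have p_pr : prime p by move/fintype.subsetP : GP => /(_ _ pG); rewrite inE.
have qX : (q < X.+1)%N.
  have p0 : (0 < p.-1)%N by have := prime_gt1 p_pr; case: (nat_of_ord p) => [|[]].
  by rewrite (leq_ltn_trans (dvdn_leq p0 qp))// (leq_ltn_trans (leq_pred _)).
by exists (p, Ordinal qX) => //=; rewrite pG inE q_pr qp.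
Qed.

(** The power of the gcd is at most the sum of d^beta over all common divisors d. Exchanging sums
    leaves primes p = 1 modulo d, which contribute a factor 1/d. Of the exponent 10 s, [sigma_ratio]
    uses 2 s and the sum of d^(beta - 1) over d | M uses 8 s. *)
Lemma sum_gcd_primes (R : realType) (X J M : nat) (beta s : R) :
  (0 < M)%N -> (X < 2 ^ J)%N -> 0 <= beta <= 4^-1 ->
  \sum_(q <- primes M) q%:R `^ (beta - 1) <= 2 * s ->
  \sum_(p in prime_set X) p%:R^-1 * (gcdn p.-1 M)%:R `^ beta
    <= 40 * expR (10 * s) * \sum_(0 <= j < J) j.+1%:R^-1.
Proof.
move=> M0 XJ /andP[b0 b1] sM; set HJ := \sum_(0 <= j < J) _.
have HJ0 : 0 <= HJ by exact: sumr_ge0.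
have prime_ge2 (p : nat) : prime p -> 2 <= p%:R :> R by move=> /prime_gt1; rewrite (ler_nat R 2).
apply: (@le_trans _ _ (\sum_(p in prime_set X) \sum_(d <- divisors M | (d %| p.-1)%N)
    p%:R^-1 * d%:R `^ beta)).
  apply: ler_sum => p _; rewrite -mulr_sumr; apply: ler_wpM2l; first by rewrite invr_ge0.
  rewrite -big_filter (bigD1_seq (gcdn p.-1 M))/=.
  - by rewrite lerDl; apply: sumr_ge0 => d _; exact: powR_ge0.
  - by rewrite mem_filter dvdn_gcdl -dvdn_divisors// dvdn_gcdr.
  - by rewrite filter_uniq ?divisors_uniq.
rewrite (exchange_big_dep xpredT)//=.
apply: (@le_trans _ _ (\sum_(d <- divisors M) 40 * sigma_ratio R M * HJ * d%:R `^ (beta - 1))).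
  rewrite big_seq [leRHS]big_seq; apply: ler_sum => d; rewrite -dvdn_divisors// => dM.
  have d0 := dvdn_gt0 M0 dM.
  have d0' : 0 < d%:R :> R by rewrite ltr0n.
  rewrite -mulr_suml.
  rewrite powRD; last by rewrite (gt_eqF d0') implybT.
  rewrite powR_inv1; last exact: ltW.
  rewrite [_ `^ _ * _]mulrC mulrA; apply: ler_wpM2r; first exact: powR_ge0.
  apply: (@le_trans _ _ (40 * sigma_ratio R d / d%:R * HJ)).
    apply: le_trans (sum_inv_primes_AP R d0 XJ).
    rewrite big_filter -[iota 0 X.+1]/(index_iota 0 X.+1) big_mkord.
    by apply: ler_sum_widen => // p /andP[]; rewrite inE => -> ->.
  rewrite mulrAC; apply: ler_wpM2r; first by rewrite invr_ge0.
  apply: ler_wpM2r => //; apply: ler_wpM2l => //; exact: sigma_ratio_dvdn.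
rewrite -mulr_sumr.
have h1 : sigma_ratio R M <= expR (2 * s).
  apply: (@le_trans _ _ (expR (\sum_(q <- primes M) q%:R `^ (beta - 1)))); last by rewrite ler_expR.
  rewrite expR_sum /sigma_ratio big_seq [leRHS]big_seq; apply: ler_prod => q.
  rewrite mem_primes => /andP[q_pr _]; rewrite addr_ge0 ?invr_ge0//=.
  apply: le_trans (expR_ge1Dx _); rewrite lerD2l -powR_inv1//.
  by apply: ler_powR; [have := prime_ge2 _ q_pr; lra | lra].
have h2 : \sum_(d <- divisors M) d%:R `^ (beta - 1) <= expR (8 * s).
  apply: le_trans (sum_divisors_le M0 _ _ _ _) _.
  - by move=> m n; rewrite natrM powRM.
  - by rewrite powR1.
  - by move=> n; exact: powR_ge0.
  - move=> p /prime_ge2 p2.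
    apply: (@le_trans _ _ (2 `^ (- 2^-1))).
      apply: (@le_trans _ _ (p%:R `^ (- 2^-1))); first by apply: ler_powR; lra.
      rewrite !powRN lef_pV2 ?posrE ?powR_gt0//; last by lra.
      by apply: ge0_ler_powR; rewrite ?nnegrE//; lra.
    rewrite powRN powR12_sqrt//.
    have r0 : 0 < Num.sqrt 2 :> R by rewrite sqrtr_gt0.
    have r2 : Num.sqrt 2 ^+ 2 = 2 :> R by rewrite sqr_sqrtr.
    rewrite -[leLHS]mul1r ler_pdivrMr//; nra.
  - by rewrite ler_expR; lra.
have -> : 40 * expR (10 * s) * HJ = 40 * expR (2 * s) * HJ * expR (8 * s).
  rewrite (_ : 10 * s = 2 * s + 8 * s); last by ring.
  by rewrite expRD; ring.
apply: ler_pM => //.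
- by rewrite !mulr_ge0// (le_trans _ (sigma_ratio_ge1 _ _)).
- by apply: sumr_ge0 => d _; exact: powR_ge0.
by apply: ler_wpM2r => //; apply: ler_wpM2l.
Qed.

(** Adjoining a prime i replaces M by lcm (i - 1, M) = (i - 1) M / gcd (i - 1, M), so the term grows
    by at most 2 gcd^beta / i. The gcd sum bounds the total growth uniformly in [G], as
    [sum_sets_le_exp] requires. *)
Lemma sum_nonexceptional (R : realType) (X J : nat) (u delta beta s : R) :
  1 <= u -> (X < 2 ^ J)%N -> 0 <= beta <= 4^-1 ->
  \sum_(q <- [seq q <- iota 0 (Num.truncn u).+1 | prime q]) q%:R `^ (beta - 1) <= s ->
  delta * u `^ beta <= s -> 0 <= delta ->
  \sum_(G : {set 'I_X.+1} | (G \subset prime_set X) &&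
      (\sum_(p in G) rough_weight X u p <= delta * Num.sqrt u))
    (\prod_(p in G) p%:R^-1) * ((\prod_(p in G) p)%:R / (lcm_pred G)%:R) `^ beta
    <= expR (80 * expR (10 * s) * \sum_(0 <= j < J) j.+1%:R^-1).
Proof.
move=> u1 XJ bb sm1 sm2 d0; set HJ := \sum_(0 <= j < J) _.
have /andP[b0 b1] := bb.
pose ok (G : {set 'I_X.+1}) := (G \subset prime_set X) &&
  (\sum_(p in G) rough_weight X u p <= delta * Num.sqrt u).
pose W (G : {set 'I_X.+1}) : R :=
  (\prod_(p in G) p%:R^-1) * ((\prod_(p in G) p)%:R / (lcm_pred G)%:R) `^ beta.
have W0 G : 0 <= W G by rewrite mulr_ge0 ?powR_ge0 ?prodr_ge0.
(* Both conditions in [ok] pass to subsets, so a set that fails has only failing extensions and the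
   growth inequality reads 0 <= 0 there. *)
pose V G : R := if ok G then W G else 0.
rewrite -[leLHS]/(\sum_(G | ok G) W G) big_mkcond.
apply: (@le_trans _ _ (V set0 * expR (80 * expR (10 * s) * HJ))); last first.
  rewrite ler_piMl ?expR_ge0// /V; case: ifP => // _.
  by rewrite /W /lcm_pred !big_set0 divr1 powR1 mulr1.
apply: (@sum_sets_le_exp _ _ V).
- by rewrite !mulr_ge0 ?expR_ge0//; exact: sumr_ge0.
- by move=> G; rewrite /V; case: ifP.
move=> G; have [okG|nokG] := boolP (ok G); last first.
  have -> : V G = 0 by rewrite /V (negbTE nokG).
  rewrite mulr0 big1// => i iG; rewrite /V; case: ifPn => // /andP[iGP iGH].
  case/negP: nokG; apply/andP; split; first by apply: fintype.subset_trans iGP; exact: subsetUr.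
  by apply: le_trans iGH; rewrite big_setU1//= lerDr rough_weight_ge0.
have -> : V G = W G by rewrite /V okG.
have /andP[GP HG] := okG.
have M0 := lcm_pred_gt0 GP; set M := lcm_pred G in M0.
have sM := sum_primes_lcm_pred u1 bb GP sm1 sm2 HG.
have gcd_sum := sum_gcd_primes M0 XJ bb sM.
apply: (@le_trans _ _ (\sum_(p in prime_set X)
    2 * W G * (p%:R^-1 * (gcdn p.-1 M)%:R `^ beta))); last first.
  rewrite -mulr_sumr; apply: (@le_trans _ _ (2 * W G * (40 * expR (10 * s) * HJ))).
    by apply: ler_wpM2l => //; rewrite mulr_ge0.
  by rewrite le_eqVlt; apply/orP; left; apply/eqP; ring.
rewrite big_mkcond [leRHS]big_mkcond; apply: ler_sum => i _.
have RHS0 : 0 <= 2 * W G * (i%:R^-1 * (gcdn i.-1 M)%:R `^ beta).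
  apply: mulr_ge0; first exact: mulr_ge0.
  by apply: mulr_ge0; rewrite ?invr_ge0 ?powR_ge0.
case: ifPn => iG; last by case: ifP.
rewrite /V; case: ifPn => [/andP[iGP _]|_]; last by case: ifP.
have iP : i \in prime_set X by move/fintype.subsetP : iGP; apply; exact: setU11.
rewrite iP; move: (iP); rewrite inE => i_pr.
have i1 := prime_gt1 i_pr.
have i10 : (0 < i.-1)%N by move: i1; case: (nat_of_ord i) => [|[]].
have i2 : i%:R <= 2 * i.-1%:R :> R by rewrite -natrM ler_nat mul2n -addnn -[X in (X <= _)%N](prednK (ltnW i1)) -addn1 leq_add2l.
have g0 : (0 < gcdn i.-1 M)%N by rewrite gcdn_gt0 M0 orbT.
rewrite /W !big_setU1//= (_ : lcm_pred (i |: G) = lcmn i.-1 M); last first.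
  by rewrite /lcm_pred big_setU1.
have key : (i * \prod_(p in G) p)%:R / (lcmn i.-1 M)%:R <=
    2 * (gcdn i.-1 M)%:R * ((\prod_(p in G) p)%:R / M%:R) :> R.
  have l0 : (0 < lcmn i.-1 M)%N by rewrite lcmn_gt0 i10.
  have lg : (lcmn i.-1 M)%:R * (gcdn i.-1 M)%:R = i.-1%:R * M%:R :> R.
    by rewrite -!natrM muln_lcm_gcd.
  have M0' : 0 < M%:R :> R by rewrite ltr0n.
  rewrite ler_pdivrMr ?ltr0n// natrM.
  rewrite [leRHS](_ : _ = 2 * i.-1%:R * (\prod_(p in G) p)%:R).
    by apply: ler_wpM2r.
  apply: (@mulIf _ M%:R); first by rewrite gt_eqF.
  rewrite -[RHS]mulrAC -[in RHS](mulrA 2) -lg; field; by rewrite gt_eqF.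
have key2 : ((i * \prod_(p in G) p)%:R / (lcmn i.-1 M)%:R) `^ beta <=
    2 * (gcdn i.-1 M)%:R `^ beta * ((\prod_(p in G) p)%:R / M%:R) `^ beta.
  apply: (@le_trans _ _ ((2 * (gcdn i.-1 M)%:R * ((\prod_(p in G) p)%:R / M%:R)) `^ beta)).
    by apply: ge0_ler_powR => //; rewrite nnegrE ?mulr_ge0 ?divr_ge0.
  rewrite powRM ?mulr_ge0 ?invr_ge0// powRM//; apply: ler_wpM2r; first exact: powR_ge0.
  apply: ler_wpM2r; first exact: powR_ge0.
  by apply: ler1_powR; lra.
apply: (le_trans (ler_wpM2l _ key2)); first by rewrite mulr_ge0 ?prodr_ge0.
by rewrite le_eqVlt; apply/orP; left; apply/eqP; rewrite /M; ring.
Qed.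

Lemma sum_inv_k_sqrt_k (R : realType) (X : nat) :
  \sum_(k : 'I_X.+1 | (0 < k)%N) (k%:R * Num.sqrt k%:R)^-1 <= 3 :> R.
Proof.
under eq_bigl do rewrite -(andbT (0 < _)%N).
rewrite (big_pos_ord _ _ xpredT (fun k => (k%:R * Num.sqrt k%:R)^-1 : R)) big_add1/=.
case: X => [|X]; first by rewrite big_geq.
rewrite big_ltn// sqrtr1 mulr1 invr1 (_ : 3 = 1 + 2); last by ring.
rewrite lerD2l; apply: (le_trans (sum_inv_sqrt_le _ _ _)) => //.
by rewrite sqrtr1 divr1.
Qed.

(** * Rankin's trick *)

(** Each counted integer receives a weight [f G * g k] of at least 1, and the weights are then
    summed over all pairs. Exceptional sets get the plain weight without powers of beta, since their
    total is already small. *)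
Lemma carmichael_count_le (R : realType) (x y u delta beta s : R) (J : nat) :
  0 < x -> 0 < y -> 1 <= u -> (Num.truncn x < 2 ^ J)%N -> 0 <= beta <= 4^-1 ->
  \sum_(q <- [seq q <- iota 0 (Num.truncn u).+1 | prime q]) q%:R `^ (beta - 1) <= s ->
  delta * u `^ beta <= s -> 0 <= delta ->
  (carmichael_count x y)%:R <=
    3 * x * (expR (40 * expR 24 * (\sum_(0 <= j < J) j.+1%:R^-1) - delta * u) +
       (y / x) `^ beta * expR (80 * expR (10 * s) * \sum_(0 <= j < J) j.+1%:R^-1)).
Proof.
move=> x0 y0 u1 XJ bb sm1 sm2 d0; have /andP[b0 b1] := bb.
set X := Num.truncn x in XJ.
have Xx : X%:R <= x by rewrite truncn_le// ltW.
pose Q (j : {set 'I_X.+1} * 'I_X.+1) := [&& (j.1 \subset prime_set X) && (0 < j.2)%N,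
  (\prod_(p in j.1) p * j.2 ^ 2 <= X)%N & (lcm_pred j.1)%:R <= y].
pose ex (G : {set 'I_X.+1}) := delta * Num.sqrt u < \sum_(p in G) rough_weight X u p.
pose f (G : {set 'I_X.+1}) : R := x * (if ex G then \prod_(p in G) p%:R^-1 else
  (y / x) `^ beta * ((\prod_(p in G) p%:R^-1) *
     ((\prod_(p in G) p)%:R / (lcm_pred G)%:R) `^ beta)).
have f0 G : 0 <= f G.
  rewrite /f; apply: mulr_ge0; first exact: ltW.
  by case: ifP => _; rewrite ?mulr_ge0 ?powR_ge0 ?prodr_ge0.
(* Rankin's weight would give k^(-2 (1 - beta)). As beta <= 1/4, the value k^(-3/2) is no smaller,
   and its sum is bounded independently of beta. *)
pose g (k : 'I_X.+1) : R := (k%:R * Num.sqrt k%:R)^-1.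
have g0 k : 0 <= g k by rewrite invr_ge0 mulr_ge0 ?sqrtr_ge0.
apply: (@le_trans _ _ (\sum_(j | Q j) (1 : R))).
  rewrite /carmichael_count natr_sum -big_filter -/X.
  apply: (@sum_le_cover R _ _ _ Q (fun j => \prod_(p in j.1) p * j.2 ^ 2)%N (fun=> 1)) => //.
    by rewrite filter_uniq ?iota_uniq.
  move=> n; rewrite mem_filter mem_index_iota ltnS => /andP[ny nX].
  have [G [k [GP k0 nE]]] := squarefree_square_decomposition nX.
  exists (G, k) => //; apply/and3P; split => /=.
  - by rewrite k0 andbT; apply/fintype.subsetP => p /GP; rewrite inE.
  - by rewrite -nE; case/andP: nX.
  apply: le_trans ny; rewrite ler_nat; apply: dvdn_leq; first exact: exponent_gt0.
  apply/dvdn_biglcmP => p pG; apply: dvdn_pred_carmichael; first by case/andP: nX.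
    exact: GP.
  by rewrite nE (bigD1 p)//= -mulnA dvdn_mulr.
apply: (@le_trans _ _ (\sum_(j : {set 'I_X.+1} * 'I_X.+1 | (j.1 \subset prime_set X) && (0 < j.2)%N)
    f j.1 * g j.2)); last first.
  rewrite (mul_sum_pair (fun G : {set 'I_X.+1} => G \subset prime_set X) (fun k : 'I_X.+1 => (0 < k)%N) f g).
  rewrite -[3 * x * _]mulrA mulrC; apply: ler_pM; rewrite ?sumr_ge0//.
    exact: sum_inv_k_sqrt_k.
  rewrite /f -mulr_sumr; apply: ler_wpM2l; first exact: ltW.
  rewrite (bigID ex)/=; apply: lerD.
    apply: le_trans (sum_exceptional delta u1 XJ).
    by rewrite le_eqVlt; apply/orP; left; apply/eqP; apply: eq_bigr => G /andP[_ ->].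
  apply: (@le_trans _ _ ((y / x) `^ beta * \sum_(G : {set 'I_X.+1} | (G \subset prime_set X) && ~~ ex G)
     ((\prod_(p in G) p%:R^-1) * ((\prod_(p in G) p)%:R / (lcm_pred G)%:R) `^ beta))).
    rewrite mulr_sumr le_eqVlt; apply/orP; left; apply/eqP.
    by apply: eq_bigr => G /andP[_ /negbTE ->].
  apply: ler_wpM2l; first exact: powR_ge0.
  apply: le_trans (sum_nonexceptional u1 XJ bb sm1 sm2 d0).
  by under eq_bigl do rewrite -leNgt.
apply: (@le_trans _ _ (\sum_(j | Q j) f j.1 * g j.2)); last first.
  apply: ler_sum_widen; first by move=> j /and3P[].
  by move=> j; rewrite mulr_ge0.
apply: ler_sum => -[G k] /and3P[/= /andP[/fintype.subsetP GP k0] GX Gy].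
set P := (\prod_(p in G) p)%N in GX *.
have P0 : (0 < P)%N by apply: prodn_cond_gt0 => p /GP; rewrite inE => /prime_gt0.
have M0 : (0 < lcm_pred G)%N by apply: lcm_pred_gt0; apply/fintype.subsetP.
have Pinv : \prod_(p in G) p%:R^-1 = P%:R^-1 :> R by rewrite natr_prod prodfV.
have P0' : 0 < P%:R :> R by rewrite ltr0n.
have M0' : 0 < (lcm_pred G)%:R :> R by rewrite ltr0n.
have k1 : 1 <= k%:R :> R by rewrite (ler_nat R 1).
have k0' : 0 < k%:R :> R by lra.
have sk0 : 0 < Num.sqrt k%:R :> R by rewrite sqrtr_gt0.
have skk : Num.sqrt k%:R ^+ 2 = k%:R :> R by rewrite sqr_sqrtr.
have sk1 : 1 <= Num.sqrt k%:R :> R by nra.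
(* This is x / n for n = P k^2; the plain weight of n is then [a] times sqrt k. *)
pose a : R := x / (P%:R * k%:R ^+ 2).
have a1 : 1 <= a.
  rewrite ler_pdivlMr ?mulr_gt0 ?exprn_gt0// mul1r; apply: le_trans Xx.
  by rewrite -natrX -natrM ler_nat.
have base : x / P%:R * g k = a * Num.sqrt k%:R.
  rewrite /a /g; move: sk0 skk; set r := Num.sqrt _ => r0 <-.
  by field; rewrite !gt_eqF.
rewrite /f/= Pinv; case: ifPn => _; first by rewrite base; nra.
set t : R := P%:R / _.
have -> : x * ((y / x) `^ beta * (P%:R^-1 * t `^ beta)) * g k =
    (a * Num.sqrt k%:R) * ((y / x) `^ beta * t `^ beta) by rewrite -base; ring.
have x0' := ltW x0; have y0' := ltW y0; have P0'' := ltW P0'.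
rewrite -powRM ?divr_ge0//.
have ak0 : 0 < a * k%:R ^+ 2 by rewrite mulr_gt0 ?exprn_gt0//; lra.
have ak1 : 1 <= a * k%:R ^+ 2 by rewrite mulr_ege1// exprn_ege1.
(* The condition [lcm_pred G <= y] enters here: it makes the Rankin base at least P / x. *)
have low : (a * k%:R ^+ 2)^-1 <= y / x * t.
  have -> : (a * k%:R ^+ 2)^-1 = P%:R / x.
    by rewrite /a; field; rewrite !gt_eqF.
  rewrite /t mulrACA [y * _]mulrC -mulrA -[leLHS]mulr1.
  have -> : P%:R * (y * (x^-1 / (lcm_pred G)%:R)) = P%:R / x * (y / (lcm_pred G)%:R) by ring.
  by rewrite ler_pM2l ?divr_gt0// ler_pdivlMr// mul1r.
have akb : (a * k%:R ^+ 2) `^ beta <= a * Num.sqrt k%:R.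
  apply: (@le_trans _ _ ((a * k%:R ^+ 2) `^ 4^-1)); first exact: ler_powR.
  rewrite powRM ?exprn_ge0//; last by lra.
  apply: ler_pM; rewrite ?powR_ge0//; first by apply: ler1_powR => //; lra.
  rewrite -powR_mulrn// -powRrM -powR12_sqrt//; apply: ler_powR => //; lra.
apply: (@le_trans _ _ (a * Num.sqrt k%:R * (a * k%:R ^+ 2)^-1 `^ beta)).
  rewrite -powR_inv1; last exact: ltW.
  rewrite -powRAC powR_inv1 ?powR_ge0//.
  by rewrite ler_pdivlMr ?powR_gt0// mul1r.
apply: ler_wpM2l; first by rewrite mulr_ge0//; lra.
apply: ge0_ler_powR => //; rewrite nnegrE; first by rewrite invr_ge0 ltW.
by rewrite mulr_ge0 ?divr_ge0 ?ltW.
Qed.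

(** * Asymptotic estimates *)

Lemma harmonic_le (R : realType) (n : nat) : (0 < n)%N ->
  \sum_(0 <= j < n) j.+1%:R^-1 <= 1 + ln n%:R :> R.
Proof.
case: n => // n _; elim: n => [|n IH].
  by rewrite big_nat1 ln1 addr0 invr1.
rewrite big_nat_recr//=; apply: (le_trans (lerD IH (lexx _))).
set a : R := n.+1%:R; have a0 : 0 < a by rewrite ltr0n.
have -> : n.+2%:R = a + 1 by rewrite /a natr1.
have a1 : 0 < a + 1 by lra.
have : ln (a / (a + 1)) <= - (a + 1)^-1.
  rewrite (_ : a / (a + 1) = 1 + - (a + 1)^-1); last by field; rewrite gt_eqF.
  by apply: le_ln1Dx; rewrite ltrN2 invf_lt1//; lra.
by rewrite ln_div ?posrE//; lra.
Qed.

(** The case d = 1 of the prime count is Chebyshev's upper bound; it is applied on each dyadic block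
    of q - 1. *)
Lemma sum_prime_powers_dyadic (R : realType) (U J : nat) (beta : R) :
  0 <= beta -> (U < 2 ^ J)%N ->
  \sum_(q <- [seq q <- iota 0 U.+1 | prime q]) q%:R `^ (beta - 1)
    <= 40 * \sum_(0 <= j < J) (2 ^ j.+1)%:R `^ beta / j.+1%:R.
Proof.
move=> b0 UJ.
apply: (@le_trans _ _ (\sum_(1 <= m < 2 ^ J | prime (1 * m + 1)) (1 * m + 1)%:R `^ (beta - 1))).
  rewrite -big_pos_ord.
  apply: (@sum_le_cover R _ _ _ _ (fun m : 'I_(2 ^ J) => (1 * m + 1)%N)
    (fun p => p%:R `^ (beta - 1))).
  - by rewrite filter_uniq ?iota_uniq.
  - by move=> p; exact: powR_ge0.
  move=> p; rewrite mem_filter mem_iota /= => /andP[p_pr pU].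
  have p1 := prime_gt1 p_pr.
  have mJ : (p.-1 < 2 ^ J)%N by lia.
  have mE : (1 * p.-1 + 1 = p)%N by lia.
  by exists (Ordinal mJ) => //=; rewrite mE p_pr andbT; lia.
elim: J {U UJ} => [|J IH]; first by rewrite !big_geq// mulr0.
have p0 : (0 < 2 ^ J)%N by rewrite expn_gt0.
rewrite (@big_cat_nat _ _ _ (2 ^ J))//=; last by rewrite leq_exp2l.
rewrite big_nat_recr//= mulrDr; apply: lerD => //.
have p0' : 0 < (2 ^ J)%:R :> R by rewrite ltr0n.
set c : R := (2 ^ J.+1)%:R `^ beta.
rewrite -{1}[(2 ^ J)%N]add0n big_addn.
have -> : (2 ^ J.+1 - 2 ^ J = 2 ^ J)%N by rewrite expnS mul2n -addnn addnK.
have c0 : 0 <= c by exact: powR_ge0.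
apply: (@le_trans _ _ (\sum_(0 <= m < 2 ^ J | prime (1 * (2 ^ J + m) + 1)) 1%:R * (c / (2 ^ J)%:R))).
  rewrite big_nat_cond [leRHS]big_nat_cond.
  rewrite (eq_bigl (fun m => (0 <= m < 2 ^ J)%N && prime (1 * (2 ^ J + m) + 1))); last first.
    by move=> m; rewrite (addnC m).
  apply: ler_sum => m /andP[/andP[_ mJ] _]; rewrite mul1r mul1n.
  have q0 : 0 < (m + 2 ^ J + 1)%:R :> R by rewrite ltr0n addn1.
  rewrite powRD; last by rewrite (gt_eqF q0) implybT.
  rewrite powR_inv1; last exact: ltW.
  apply: ler_pM; rewrite ?powR_ge0 ?invr_ge0//.
  - apply: ge0_ler_powR; rewrite ?nnegrE// ler_nat expnS; lia.
  - by rewrite lef_pV2 ?posrE// ler_nat; lia.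
have := count_primes_dyadic R J (isT : 0 < 1)%N; rewrite natr_sum => H.
rewrite -mulr_suml; apply: (le_trans (ler_wpM2r _ H)); first exact: divr_ge0.
rewrite /sigma_ratio big_nil mulr1 le_eqVlt; apply/orP; left; apply/eqP; field.
by rewrite !gt_eqF//= addrC natr1 ltr0n.
Qed.

Lemma expR_ge_half_sqr (R : realType) (t : R) : 0 <= t -> t ^+ 2 / 2 <= expR t.
Proof. by move=> t0; have := expR_ge1Dxn 1 t0; rewrite /= -[(2`!)%:R]/(2 : R); lra. Qed.

Lemma sum_geometric_expR (R : realType) (a : R) (J : nat) : 0 < a ->
  \sum_(0 <= j < J) expR (a * j.+1%:R) <= expR (a * J.+1%:R) / a.
Proof.
move=> a0; elim: J => [|J IH]; first by rewrite big_geq// divr_ge0 ?expR_ge0// ltW.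
rewrite big_nat_recr//=; apply: (le_trans (lerD IH (lexx _))).
have e0 := expR_gt0 (a * J.+1%:R); have := expR_ge1Dx a => ea.
rewrite -[J.+2%:R]natr1 mulrDr mulr1 expRD ler_pdivlMr// mulrDl divfK ?gt_eqF//.
nra.
Qed.

Lemma half_le_ln2 (R : realType) : 2^-1 <= ln 2 :> R.
Proof.
have := @le_ln1Dx R (- 2^-1); rewrite (_ : 1 + - 2^-1 = 2^-1); last by field.
by rewrite lnV ?posrE//; lra.
Qed.

(** With [l = ln u] and [v = ln l], the dyadic terms grow geometrically up to order l / J, and only
    about the top J / v of them matter. The total has order l / v, below [delta * l] once [v] is
    large. *)
Lemma sum_prime_powers_le (R : realType) (u delta : R) :
  0 < delta -> 8 + 64 * (40 / delta) <= ln (ln u) ->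
  \sum_(q <- [seq q <- iota 0 (Num.truncn u).+1 | prime q])
     q%:R `^ (ln (ln u) / ln u - 1) <= delta * ln u.
Proof.
move=> d0; set l := ln u; set v := ln l => vbig.
have dv : 0 < 40 / delta by rewrite divr_gt0.
have v8 : 8 <= v by lra.
have l0 : 0 < l.
  by rewrite ltNge; apply/negP => l0; move: v8; rewrite /v ln0//; lra.
have lE : l = expR v by rewrite lnK.
have lv : v <= l by rewrite lE; have := expR_ge1Dx v; lra.
have u0 : 0 < u.
  by rewrite ltNge; apply/negP => u0; move: l0; rewrite /l ln0// ltxx.
have uE : u = expR l by rewrite lnK.
pose b := v / l; have b0 : 0 < b by rewrite divr_gt0//; lra.
have b1 : b <= 1 by rewrite ler_pdivrMr// mul1r.
have ln2 := half_le_ln2 R.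
have ln2' : ln 2 <= 1 :> R by have := @le_ln1Dx R 1; lra.
have pow2 n : (2 ^ n)%:R = expR (n%:R * ln 2) :> R by rewrite expRM_natl lnK ?posrE// natrX.
pose J := (Num.truncn (l / ln 2)).+1.
have ll0 : 0 <= l / ln 2 by rewrite divr_ge0//; lra.
have /andP[J1 J2] := truncn_itv ll0.
have J2' : l < J%:R * ln 2 by rewrite -ltr_pdivrMr//; lra.
have J1' : J%:R * ln 2 <= l + ln 2.
  by rewrite /J -natr1 mulrDl mul1r lerD2r -ler_pdivlMr//; lra.
have J0 : 0 < J%:R :> R by [].
have UJ : (Num.truncn u < 2 ^ J)%N.
  rewrite -(ltr_nat R); apply: (@le_lt_trans _ _ u); first by rewrite truncn_le ltW.
  by rewrite pow2 uE ltr_expR.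
apply: (le_trans (sum_prime_powers_dyadic (ltW b0) UJ)).
pose a := b * ln 2; have a0 : 0 < a by rewrite mulr_gt0//; lra.
have termE j : (2 ^ j.+1)%:R `^ b = expR (a * j.+1%:R).
  by rewrite pow2 /powR gt_eqF ?expR_gt0// expRK /a; congr expR; ring.
under eq_bigr do rewrite termE.
have aJ : a * J%:R <= v + 1.
  rewrite (_ : a * _ = b * (J%:R * ln 2)); last by rewrite /a; ring.
  apply: (le_trans (ler_wpM2l (ltW b0) J1')); rewrite mulrDr /b divfK ?gt_eqF//.
  rewrite lerD2l; have : b * ln 2 <= 1 * 1 by apply: ler_pM; lra. by rewrite mul1r.
(* The blocks are split at J/2. Below it the exponential is of order at most sqrt l; above it 1/(j +
   1) is less than 2/J and a geometric sum remains. *)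
have pt j : (j < J)%N -> expR (a * j.+1%:R) / j.+1%:R <=
    expR ((v + 1) / 2) * j.+1%:R^-1 + 2 / J%:R * expR (a * j.+1%:R).
  move=> jJ; have j0 : 0 < j.+1%:R :> R by [].
  have [jh|jh] := leP (2 * j.+1%:R) (J%:R : R).
    apply: ler_wpDr; first by rewrite mulr_ge0 ?expR_ge0 ?divr_ge0.
    by apply: ler_wpM2r; rewrite ?invr_ge0// ler_expR; nra.
  apply: ler_wpDl; first by rewrite mulr_ge0 ?expR_ge0 ?invr_ge0.
  rewrite mulrC; apply: ler_wpM2r; first exact: expR_ge0.
  by rewrite ler_pdivlMr// mulrC ler_pdivrMr// ltW.
have step : \sum_(0 <= j < J) expR (a * j.+1%:R) / j.+1%:R <=
   expR ((v + 1) / 2) * (1 + ln J%:R) + 2 / J%:R * (expR (a * J.+1%:R) / a).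
  apply: (@le_trans _ _ (\sum_(0 <= j < J) (expR ((v + 1) / 2) * j.+1%:R^-1 +
     2 / J%:R * expR (a * j.+1%:R)))).
    by apply: ler_sum_nat => j /andP[_ jJ]; exact: pt.
  rewrite big_split/= -!mulr_sumr; apply: lerD.
    by apply: ler_wpM2l; [exact: expR_ge0 | exact: harmonic_le].
  by apply: ler_wpM2l; [rewrite divr_ge0 | exact: sum_geometric_expR].
have lnJ : 1 + ln J%:R <= 3 * v.
  have Jl : J%:R <= l ^+ 2 by nra.
  have : ln J%:R <= ln (l ^+ 2) by rewrite ler_ln ?posrE// exprn_gt0.
  by rewrite lnXn// -/v mulr2n; lra.
have t1 : expR ((v + 1) / 2) * (1 + ln J%:R) <= 48 * l / v.
  have h2 : expR (1 / 2) <= 2 :> R.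
    have := expR_ge1Dx (- (1 / 2) : R); have := expR_gt0 (1 / 2 : R).
    have : expR (1 / 2) * expR (- (1 / 2)) = 1 :> R by rewrite -expRD subrr expR0.
    nra.
  have h3 : (v / 2) ^+ 2 / 2 <= expR (v / 2) by apply: expR_ge_half_sqr; lra.
  have h4 : l = expR (v / 2) * expR (v / 2).
    by rewrite -expRD lE; congr expR; field.
  rewrite ler_pdivlMr; last by lra.
  rewrite mulrDl expRD; have e0 := expR_gt0 (v / 2).
  set e := expR (v / 2) in h3 h4 e0 *; set f := expR (1 / 2) in h2 *.
  have f0 : 0 < f by exact: expR_gt0.
  have lJ0 : 0 <= 1 + ln (J%:R : R).
    by apply: addr_ge0 => //; apply: ln_ge0; rewrite (ler_nat R 1).
  apply: (@le_trans _ _ (e * 2 * (3 * v) * v)).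
    apply: ler_wpM2r; first by lra.
    apply: ler_pM => //; first by rewrite mulr_ge0 ?ltW.
    by apply: ler_wpM2l; first exact: ltW.
  rewrite h4 -subr_ge0 (_ : _ - _ = 48 * e * (e - (v / 2) ^+ 2 / 2)); last by field.
  by rewrite mulr_ge0 ?subr_ge0// mulr_ge0// ltW.
have t2 : 2 / J%:R * (expR (a * J.+1%:R) / a) <= 16 * l / v.
  have Ja : v <= J%:R * a.
    rewrite (_ : J%:R * a = b * (J%:R * ln 2)); last by rewrite /a; ring.
    have <- : b * l = v by rewrite /b divfK ?gt_eqF.
    by apply: ler_wpM2l; exact: ltW.
  have Ja0 : 0 < J%:R * a by rewrite mulr_gt0.
  have ea : expR (a * J.+1%:R) <= 8 * l.
    rewrite -natr1 mulrDr mulr1 expRD.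
    have e1 : expR 1 <= 4 :> R.
      have g1 := expR_ge1Dx (- (1 / 2) : R).
      have g2 : expR 1 * (expR (- (1 / 2)) * expR (- (1 / 2))) = 1 :> R.
        by rewrite -!expRD -[RHS]expR0; congr expR; field.
      set g : R := expR (- (1 / 2)) in g1 g2.
      have g3 : 1 / 4 <= g * g by nra.
      have := ler_wpM2l (expR_ge0 (1 : R)) g3; lra.
    have e2 : expR a <= 2.
      rewrite -[leRHS]lnK ?posrE// ler_expR /a -[leRHS]mul1r.
      by apply: ler_wpM2r => //; lra.
    have e3 : expR (a * J%:R) <= 4 * l.
      apply: (@le_trans _ _ (expR (v + 1))); first by rewrite ler_expR.
      by rewrite expRD -lE mulrC; apply: ler_wpM2r => //; exact: ltW.
    rewrite (_ : 8 * l = 4 * l * 2); last by ring.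
    by apply: ler_pM; rewrite ?expR_ge0.
  rewrite (_ : 2 / J%:R * _ = 2 * expR (a * J.+1%:R) / (J%:R * a)); last first.
    by field; rewrite !gt_eqF.
  rewrite ler_pdivrMr// (_ : 16 * l / v * (J%:R * a) = 16 * l * (J%:R * a) / v); last by ring.
  rewrite ler_pdivlMr; last by lra.
  by have := expR_ge0 (a * J.+1%:R); move=> E0; apply: ler_pM => //; lra.
(* The 64 in the hypothesis is 48 + 16 from the two halves, and 40 comes from the prime count. *)
apply: (@le_trans _ _ (64 * (40 / delta) / v * (delta * l))).
  rewrite (_ : 64 * (40 / delta) / v * (delta * l) = 40 * (48 * l / v + 16 * l / v)).
    by apply: ler_wpM2l => //; apply: (le_trans step); exact: lerD.
  by field; rewrite !gt_eqF//; lra.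
rewrite ler_piMl ?mulr_ge0 ?(ltW l0) ?(ltW d0)// ler_pdivrMr ?mul1r; lra.
Qed.

Lemma harmonic_dyadic_le (R : realType) (x : R) : 9 <= ln (ln x) ->
  exists2 J : nat, (Num.truncn x < 2 ^ J)%N &
    \sum_(0 <= j < J) j.+1%:R^-1 <= 3 * ln (ln x).
Proof.
set l := ln x; set L := ln l => L9.
have l0 : 0 < l.
  by rewrite ltNge; apply/negP => l0; move: L9; rewrite /L ln0//; lra.
have x0 : 0 < x.
  by rewrite ltNge; apply/negP => x0; move: l0; rewrite /l ln0// ltxx.
have lE : l = expR L by rewrite lnK.
have l10 : 10 <= l by rewrite lE; have := expR_ge1Dx L; lra.
have ln2 := half_le_ln2 R.
have ll0 : 0 <= 2 * l by lra.
have /andP[J1 J2] := truncn_itv ll0.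
exists (Num.truncn (2 * l)).+1; set J := (Num.truncn (2 * l)).+1 in J2 *.
  rewrite -(ltr_nat R); apply: (@le_lt_trans _ _ x); first by rewrite truncn_le ltW.
  rewrite natrX -[ltLHS](lnK x0) -(@lnK R 2) ?posrE// -expRM_natl ltr_expR -/l; nra.
apply: (le_trans (harmonic_le _ _)) => //.
have Jl : J%:R <= l ^+ 2 by rewrite /J -natr1; nra.
have : ln J%:R <= ln (l ^+ 2) by rewrite ler_ln ?posrE// exprn_gt0.
by rewrite lnXn// -/L mulr2n; lra.
Qed.

(** * Comparison of exponents and conclusion *)

(** Here w is log u, [ln w / w] is beta, and exp (kappa w) = u^kappa bounds log log x. One half of d
    u absorbs beta u, because beta tends to 0; the other half absorbs the multiple of u^kappa. *)
Lemma exponent_exceptional (R : realType) (kappa d w : R) :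
  0 < kappa < 1 -> 0 < d -> 8 <= ln w -> 4 / d <= ln w ->
  2 * ((4 + 120 * expR 24) / (d * (1 - kappa))) <= ln w ->
  4 + 120 * expR 24 * expR (kappa * w) + ln w / w * expR w <= d * expR w.
Proof.
move=> /andP[k0 k1] d0; set v := ln w; set K := expR 24 => v8 vd vK.
have K0 : 0 < K by exact: expR_gt0.
have w0 : 0 < w by rewrite ltNge; apply/negP => w0; move: v8; rewrite /v ln0//; lra.
have wE : w = expR v by rewrite lnK.
have vw : v <= w by rewrite wE; have := expR_ge1Dx v; lra.
have h1 : v / w <= d / 2.
  rewrite ler_pdivrMr//; have := @expR_ge_half_sqr R v; rewrite -wE => /(_ _)H.
  have {}H : v ^+ 2 / 2 <= w by apply: H; lra.
  have vd' : 4 <= v * d by rewrite -ler_pdivrMr.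
  nra.
have e0 : 0 < expR w by exact: expR_gt0.
have h2 : v / w * expR w <= d / 2 * expR w by apply: ler_wpM2r => //; exact: ltW.
have kw1 : 1 <= expR (kappa * w) by rewrite -[leLHS]expR0 ler_expR; apply: mulr_ge0; lra.
have h3 : (4 + 120 * K) * expR (kappa * w) <= d / 2 * expR w.
  have -> : expR w = expR ((1 - kappa) * w) * expR (kappa * w) by rewrite -expRD; congr expR; ring.
  rewrite mulrA; apply: ler_wpM2r; first by lra.
  have := expR_ge1Dx ((1 - kappa) * w) => h.
  have : 2 * (4 + 120 * K) <= w * (d * (1 - kappa)).
    have dk : 0 < d * (1 - kappa) by rewrite mulr_gt0//; lra.
    by rewrite -ler_pdivrMr// -mulrA; lra.
  nra.
lra.
Qed.

(** After division by u^(1 - c) the claim is that u^c outgrows w = log u, which follows from u^c >=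
    (c w)^2 / 2. *)
Lemma exponent_nonexceptional (R : realType) (c eta w : R) :
  0 < c < 1 -> 0 < eta -> 8 <= ln w ->
  2 * ((4 + 80 * 3) / (eta * c ^+ 2)) <= ln w ->
  4 + 80 * 3 * expR ((1 - c) * w) <= eta * (ln w / w * expR w).
Proof.
move=> /andP[c0 c1] eta0; set v := ln w => v8 vc.
have w0 : 0 < w by rewrite ltNge; apply/negP => w0; move: v8; rewrite /v ln0//; lra.
have wE : w = expR v by rewrite lnK.
have vw : v <= w by rewrite wE; have := expR_ge1Dx v; lra.
have cw1 : 1 <= expR ((1 - c) * w) by rewrite -[leLHS]expR0 ler_expR; apply: mulr_ge0; lra.
apply: (@le_trans _ _ ((4 + 80 * 3) * expR ((1 - c) * w))); first by lra.
have -> : expR w = expR (c * w) * expR ((1 - c) * w) by rewrite -expRD; congr expR; ring.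
rewrite !mulrA; apply: ler_wpM2r; first by lra.
have cw0 : 0 <= c * w by rewrite mulr_ge0// ltW.
have h := expR_ge_half_sqr cw0.
have ec : 0 < eta * c ^+ 2 by rewrite mulr_gt0// exprn_gt0.
set N : R := 4 + 80 * 3 in vc *.
have h2 : 2 * N <= w * (eta * c ^+ 2) by rewrite -ler_pdivrMr// -mulrA; lra.
have h3 : N * w <= eta * expR (c * w).
  apply: (@le_trans _ _ (eta * ((c * w) ^+ 2 / 2))); last by apply: ler_wpM2l => //; exact: ltW.
  have -> : eta * ((c * w) ^+ 2 / 2) = (w * (eta * c ^+ 2)) / 2 * w by field.
  by apply: ler_wpM2r; lra.
rewrite mulrAC ler_pdivlMr//; apply: (le_trans h3).
rewrite mulrAC; apply: ler_peMr; last by lra.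
by apply: mulr_ge0; [exact: ltW | exact: expR_ge0].
Qed.

Theorem proposition7p1 (R : realType) (eps : R) (heps : 0 < eps) :
  forall eta : R, 0 < eta ->
  exists x0 : R, forall x y : R, x0 <= x ->
    100 <= y -> y <= x / expR (iter_ln 2 x `^ (1 + eps)) ->
    (carmichael_count x y)%:R <= x * scriptL (x / y) `^ (-1 + eta).
Proof.
move=> eta eta0.
(* The hypothesis on y gives u >= (log log x)^(1 + eps), that is, log log x <= u^kappa. *)
pose kappa := (1 + eps)^-1.
have k0 : 0 < kappa by rewrite invr_gt0; lra.
have k1 : kappa < 1 by rewrite invf_lt1//; lra.
(* With s = d log u, exp (10 s) is u^((1 - kappa) / 2); multiplied by u^kappa it is u^(1 - c), still
   a power below u. *)
pose d := (1 - kappa) / 20; have d0 : 0 < d by rewrite divr_gt0//; lra.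
pose c := (1 - kappa) / 2.
have c0 : 0 < c by rewrite divr_gt0//; lra.
have c1 : c < 1 by rewrite /c; lra.
pose t1 := 64 * (40 / d); pose t2 := 4 / d.
pose t3 := 2 * ((4 + 120 * expR 24) / (d * (1 - kappa))).
pose t4 := 2 * ((4 + 80 * 3) / (eta * c ^+ 2)).
have t10 : 0 <= t1 by rewrite mulr_ge0// divr_ge0// ltW.
have t20 : 0 <= t2 by rewrite divr_ge0// ltW.
have t30 : 0 <= t3.
  apply: mulr_ge0 => //; apply: divr_ge0.
    by apply: addr_ge0 => //; apply: mulr_ge0 => //; exact: expR_ge0.
  by apply: mulr_ge0; lra.
have t40 : 0 <= t4.
  apply: mulr_ge0 => //; apply: divr_ge0; first by lra.
  by apply: mulr_ge0; [exact: ltW | apply: exprn_ge0; exact: ltW].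
(* A common lower bound for log log log (x / y): [t1] serves the prime sum, [t2] and [t3] the
   exceptional exponent, [t4] the other one. As u >= log log x, two exponentials yield [u0] and two
   more the threshold for x. *)
pose v0 := 8 + t1 + t2 + t3 + t4.
have [v08 v01 v02] : [/\ 8 <= v0, 8 + t1 <= v0 & t2 <= v0] by rewrite /v0; split; lra.
have [v03 v04] : t3 <= v0 /\ t4 <= v0 by rewrite /v0; split; lra.
clearbody v0.
pose u0 := expR (expR v0).
have u09 : 9 <= u0.
  have := expR_ge1Dx v0; have := expR_ge1Dx (expR v0); rewrite -/u0; lra.
exists (expR (expR u0)) => x y xx y100 yx.
have x0 : 0 < x by apply: lt_le_trans xx; exact: expR_gt0.
have y0 : 0 < y by lra.
set L := ln (ln x).
have Lu0 : u0 <= L.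
  have lx : expR u0 <= ln x by rewrite -[leLHS]expRK ler_ln ?posrE ?expR_gt0.
  by rewrite -[leLHS]expRK ler_ln ?posrE ?expR_gt0//; apply: lt_le_trans lx; exact: expR_gt0.
have xy0 : 0 < x / y by rewrite divr_gt0.
pose u := ln (x / y).
have uL : L `^ (1 + eps) <= u.
  rewrite -[leLHS]expRK ler_ln ?posrE ?expR_gt0// ler_pdivlMr//.
  by rewrite mulrC -ler_pdivlMr ?expR_gt0.
have Lu : L <= u by apply: le_trans uL; apply: le1r_powR; lra.
have uu0 : u0 <= u by lra.
have u_gt0 : 0 < u by lra.
pose w := ln u.
have ww0 : expR v0 <= w by rewrite -[leLHS]expRK ler_ln ?posrE ?expR_gt0.
have w0 : 0 < w by apply: lt_le_trans ww0; exact: expR_gt0.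
pose v := ln w.
have vv0 : v0 <= v by rewrite -[leLHS]expRK ler_ln ?posrE ?expR_gt0.
have uE : u = expR w by rewrite lnK.
have wE : w = expR v by rewrite lnK.
have Lk : L <= expR (kappa * w).
  have <- : u `^ kappa = expR (kappa * w) by rewrite /powR gt_eqF.
  have L1 : L = (L `^ (1 + eps)) `^ kappa.
    by rewrite -powRrM mulfV ?gt_eqF ?powRr1//; lra.
  by rewrite L1; apply: ge0_ler_powR; rewrite ?nnegrE ?powR_ge0// ltW.
have [J xJ HJ] : exists2 J : nat, (Num.truncn x < 2 ^ J)%N &
    \sum_(0 <= j < J) j.+1%:R^-1 <= 3 * L.
  by apply: harmonic_dyadic_le; rewrite -/L; lra.
set H := \sum_(0 <= j < J) _ in HJ.
have H0 : 0 <= H by exact: sumr_ge0.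
have Hk : H <= 3 * expR (kappa * w) by lra.
pose b := v / w.
have v8 : 8 <= v by exact: le_trans vv0.
have b0 : 0 <= b by apply: divr_ge0; [exact: le_trans v8 | exact: ltW].
have b4 : b <= 4^-1.
  rewrite ler_pdivrMr//; have : v ^+ 2 / 2 <= w by rewrite [leRHS]wE; apply: expR_ge_half_sqr; lra.
  nra.
have ub : u `^ b = w.
  by rewrite /powR gt_eqF// -/w /b divfK ?gt_eqF.
have prime_sum : \sum_(q <- [seq q <- iota 0 (Num.truncn u).+1 | prime q])
    q%:R `^ (b - 1) <= d * w.
  by apply: sum_prime_powers_le => //; exact: le_trans vv0.
have u1 : 1 <= u by lra.
have bb : 0 <= b <= 4^-1 by rewrite b0.
have sm2 : d * u `^ b <= d * w by rewrite ub.
apply: (le_trans (carmichael_count_le x0 y0 u1 xJ bb prime_sum sm2 (ltW d0))).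
rewrite -/H.
have -> : scriptL (x / y) `^ (-1 + eta) = expR (b * u * (-1 + eta)).
  rewrite /scriptL -expRM /iter_ln /= -/u -/w -/v /b; congr expR; ring.
have -> : (y / x) `^ b = expR (- (b * u)).
  rewrite /powR gt_eqF ?divr_gt0// (_ : y / x = (x / y)^-1); last by rewrite invf_div.
  by rewrite lnV ?posrE// -/u mulrN.
(* The final bound is 3 x times a sum of two terms, so 6 times each must stay below the target; the
   summand 4 in both exponent lemmas pays for this 6. *)
have e4 : 6 <= expR 4 :> R by have := @expR_ge_half_sqr R 4; lra.
have kk : 0 < kappa < 1 by rewrite k0.
have cc : 0 < c < 1 by rewrite c0.
have A1 := @exponent_exceptional R kappa d w kk d0.
have A2 := @exponent_nonexceptional R c eta w cc eta0.
rewrite -/v -/b -uE in A1 A2.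
have {}A1 : 4 + 120 * expR 24 * expR (kappa * w) + b * u <= d * u.
  by apply: A1 => //; [exact: le_trans vv0 | exact: le_trans vv0].
have {}A2 : 4 + 80 * 3 * expR ((1 - c) * w) <= eta * (b * u).
  by apply: A2 => //; exact: le_trans vv0.
have B1 : 6 * expR (40 * expR 24 * H - d * u) <= expR (b * u * (-1 + eta)).
  apply: (@le_trans _ _ (expR 4 * expR (40 * expR 24 * H - d * u))).
    by apply: ler_wpM2r => //; exact: expR_ge0.
  rewrite -expRD ler_expR.
  have := ler_wpM2l (expR_ge0 (24 : R)) Hk.
  have : 0 <= eta * (b * u).
    by apply: mulr_ge0; [exact: ltW | apply: mulr_ge0 => //; exact: ltW].
  lra.
have B2 : 6 * (expR (- (b * u)) * expR (80 * expR (10 * (d * w)) * H)) <= expR (b * u * (-1 + eta)).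
  apply: (@le_trans _ _ (expR 4 * (expR (- (b * u)) * expR (80 * expR (10 * (d * w)) * H)))).
    by apply: ler_wpM2r => //; rewrite mulr_ge0 ?expR_ge0.
  rewrite -!expRD ler_expR.
  have := ler_wpM2l (expR_ge0 (10 * (d * w))) Hk.
  have : expR (10 * (d * w)) * expR (kappa * w) = expR ((1 - c) * w).
    by rewrite -expRD; congr expR; rewrite /d /c; field.
  lra.
rewrite -[leLHS]mulrA [leLHS]mulrCA; apply: ler_wpM2l; first exact: ltW.
lra.
Qed.
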